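(* Let $r,k\in\mathbb Z$ with $0\le k\le r$ and suppose Assumptions (A1), (A2), (A3) hold. Then for $1\le n\le N$, $0\le l\le r$ and all $v\in C^{k_{\mathcal J}+1}(\overline I_n,\mathbb R^d)$, $$\sup_{t\in I_n}\|(\mathcal J_nv)^{(l)}(t)\|\le C\sum_{j=0}^{k_{\mathcal J}+1}\big(\tfrac{\tau_n}{2}\big)^{j-l}\sup_{t\in I_n}\|v^{(j)}(t)\|$$ with $C$ independent of $\tau_n$, $n$ and $v$.
   Context: Mesh $t_0<\dots<t_N$, $I_n=(t_{n-1},t_n]$, $\tau_n=t_n-t_{n-1}\le1$; one-sided limits $v(t_n^\pm)$. $T_n(\hat t)=\frac{t_n+t_{n-1}}{2}+\frac{\tau_n}{2}\hat t$. $\|\cdot\|$, $(\cdot,\cdot)$ Euclidean norm/inner product on $\mathbb R^d$; $P_s$ polynomials of degree $\le s$; $\delta_{i,j}$ Kronecker symbol. Operators: $\widehat{\mathscr I}$ linear functional, $\widehat{\mathcal I}$ linear operator; $k_{\mathscr I},k_{\mathcal I}\ge0$ smallest integers such that they are well defined on $C^{k_{\mathscr I}}([-1,1])$ resp. $C^{k_{\mathcal I}}([-1,1])$; $\widehat{\mathcal I}\hat v\in C^l$ whenever $\hat v\in C^{\max\{k_{\mathcal I},l\}}$. Local: $\mathscr I_n[\varphi]=\frac{\tau_n}{2}\widehat{\mathscr I}[\varphi\circ T_n]$, $\mathcal I_n\psi=(\widehat{\mathcal I}(\psi\circ T_n))\circ T_n^{-1}$, componentwise. $k_{\mathcal J}:=\max\{\lfloor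 k/2\rfloor-1,k_{\mathscr I},k_{\mathcal I}\}$. $\mathcal J_n v\in P_r(I_n,\mathbb R^d)$ for $v\in C^{k_{\mathcal J}+1}(\overline I_n,\mathbb R^d)$ is defined by: if $k\ge1$, $(\mathcal J_nv)^{(i)}(t_{n-1}^+)=v^{(i)}(t_{n-1}^+)$, $i=0,\dots,\lfloor (k-1)/2\rfloor$; if $k\ge2$, $(\mathcal J_nv)^{(i)}(t_n^-)=v^{(i)}(t_n^-)$, $i=1,\dots,\lfloor k/2\rfloor$; and $\mathscr I_n[((\mathcal J_nv)',\varphi)]+\delta_{0,k}(\mathcal J_nv(t_{n-1}^+),\varphi(t_{n-1}^+))=\mathscr I_n[(\mathcal I_n(v'),\varphi)]+\delta_{0,k}(v(t_{n-1}^+),\varphi(t_{n-1}^+))$ for all $\varphi\in P_{r-k}(I_n,\mathbb R^d)$ (well defined under (A1)). (A1): whenever $\hat\psi\in P_{r-\max\{1,k\}}([-1,1])$ satisfies $\widehat{\mathscr I}[(1-\hat t)^{\lfloor k/2\rfloor}(1+\hat t)^{|\lfloor (k-1)/2\rfloor|}\hat\psi\hat\varphi]=0$ for all $\hat\varphi\in P_{r-\max\{1,k\}}([-1,1])$, then $\hat\psi\equiv0$. (A2): $\|\widehat{\mathscr I}[\hat\varphi]\|\le\mathfrak C_0\sum_{j=0}^{k_{\mathscr I}}\sup_{[-1,1]}\|\hat\varphi^{(j)}\|$ for all $\hat\varphi\in C^{k_{\mathscr I}}([-1,1],\mathbb R^d)$. (A3): for $0\le l\le k_{\mathscr I}$,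 $\sup_{[-1,1]}\|(\widehat{\mathcal I}\hat\varphi)^{(l)}\|\le\mathfrak C_1\sum_{j=0}^{\max\{k_{\mathcal I},l\}}\sup_{[-1,1]}\|\hat\varphi^{(j)}\|$ for all $\hat\varphi\in C^{\max\{k_{\mathcal I},l\}}([-1,1],\mathbb R^d)$. *)

(* Defs.v *)
From Stdlib Require Import Reals ZArith List.
From Coquelicot Require Import Coquelicot.
Open Scope R_scope.

Definition sumlt (d : nat) (f : nat -> R) : R :=
  fold_right Rplus 0 (map f (seq 0 d)).
Definition sumle (m : nat) (f : nat -> R) : R := sumlt (S m) f.

(* R^d-valued data are represented componentwise: components 0..d-1. *)
Definition vfun := nat -> R -> R.

Definition enorm (d : nat) (x : nat -> R) : R := sqrt (sumlt d (fun i => x i ^ 2)).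
Definition inner (d : nat) (x y : nat -> R) : R := sumlt d (fun i => x i * y i).

Definition Ck (m : nat) (f : R -> R) : Prop :=
  (forall j x, (j < m)%nat -> ex_derive (Derive_n f j) x) /\
  (forall x, continuous (Derive_n f m) x).
Definition vCk (d m : nat) (v : vfun) : Prop :=
  forall c, (c < d)%nat -> Ck m (v c).

Definition is_poly (s : nat) (f : R -> R) : Prop :=
  exists a : nat -> R, forall t, f t = sumle s (fun j => a j * t ^ j).
Definition vpoly (d s : nat) (p : vfun) : Prop :=
  forall c, (c < d)%nat -> is_poly s (p c).

Definition functional := (R -> R) -> R.
Definition operator := (R -> R) -> (R -> R).

Definition lin_functional (kI : nat) (I : functional) : Prop :=
  forall a b f g, Ck kI f -> Ck kI g ->
    I (fun x => a * f x + b * g x) = a * I f + b * I g.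
Definition lin_operator (kO : nat) (O : operator) : Prop :=
  forall a b f g, Ck kO f -> Ck kO g -> forall x,
    O (fun y => a * f y + b * g y) x = a * O f x + b * O g x.
Definition smoothing (kO : nat) (O : operator) : Prop :=
  forall l f, Ck (Nat.max kO l) f -> Ck l (O f).

(* affine map T_n and its inverse, for I_n = (a, b] *)
Definition Tn (a b s : R) : R := (b + a) / 2 + (b - a) / 2 * s.
Definition Tinv (a b t : R) : R := (2 * t - (b + a)) / (b - a).
Definition locI (I : functional) (a b : R) (f : R -> R) : R :=
  (b - a) / 2 * I (fun s => f (Tn a b s)).
Definition locO (O : operator) (a b : R) (f : R -> R) : R -> R :=
  fun t => O (fun s => f (Tn a b s)) (Tinv a b t).

Definition kron0 (k : nat) : R := if Nat.eqb k 0 then 1 else 0.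

(* k_J = max(floor(k/2) - 1, kI, kO) (truncation harmless since kI >= 0) *)
Definition kJ (k kI kO : nat) : nat := Nat.max (k / 2 - 1) (Nat.max kI kO).

Definition is_J (d r k : nat) (I : functional) (O : operator) (a b : R)
  (v p : vfun) : Prop :=
  vpoly d r p /\
  ((1 <= k)%nat -> forall i c, (i <= (k - 1) / 2)%nat -> (c < d)%nat ->
      Derive_n (p c) i a = Derive_n (v c) i a) /\
  ((2 <= k)%nat -> forall i c, (1 <= i <= k / 2)%nat -> (c < d)%nat ->
      Derive_n (p c) i b = Derive_n (v c) i b) /\
  (forall phi : vfun, vpoly d (r - k) phi ->
     locI I a b (fun t => inner d (fun c => Derive (p c) t) (fun c => phi c t))
       + kron0 k * inner d (fun c => p c a) (fun c => phi c a)
     = locI I a b (fun t => inner d (fun c => locO O a b (Derive (v c)) t)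
                                     (fun c => phi c t))
       + kron0 k * inner d (fun c => v c a) (fun c => phi c a)).

Definition AssumptionA1 (r k : nat) (I : functional) : Prop :=
  (Nat.max 1 k <= r)%nat ->
  forall psi, is_poly (r - Nat.max 1 k) psi ->
  (forall phi, is_poly (r - Nat.max 1 k) phi ->
     I (fun s => (1 - s) ^ (k / 2) * (1 + s) ^ (if Nat.eqb k 0 then 1 else (k - 1) / 2)
                 * psi s * phi s) = 0) ->
  forall s, -1 <= s <= 1 -> psi s = 0.

(* (AssumptionA2); sup-bounds expressed through arbitrary upper bounds M j *)
Definition AssumptionA2 (d kI : nat) (I : functional) : Prop :=
  exists C0, forall phi : vfun, vCk d kI phi ->
    forall M : nat -> R,
      (forall j s, (j <= kI)%nat -> -1 <= s <= 1 ->
          enorm d (fun c => Derive_n (phi c) j s) <= M j) ->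
      enorm d (fun c => I (phi c)) <= C0 * sumle kI M.

Definition AssumptionA3 (d kI kO : nat) (O : operator) : Prop :=
  exists C1, forall l, (l <= kI)%nat -> forall phi : vfun,
    vCk d (Nat.max kO l) phi ->
    forall M : nat -> R,
      (forall j s, (j <= Nat.max kO l)%nat -> -1 <= s <= 1 ->
          enorm d (fun c => Derive_n (phi c) j s) <= M j) ->
      forall s, -1 <= s <= 1 ->
        enorm d (fun c => Derive_n (O (phi c)) l s) <= C1 * sumle (Nat.max kO l) M.

Definition mesh (N : nat) (t : nat -> R) : Prop :=
  forall n, (1 <= n <= N)%nat -> t (n - 1)%nat < t n /\ t n - t (n - 1)%nat <= 1.

(* Main.v *)
(* The estimate is scale invariant, so it is proved on the reference interval
   [-1, 1] and transported to I_n = (a, b] by the affine map T_n.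
   1. On [-1, 1] the defining conditions of J_n are finitely many linear
      functionals of the coefficient vector of a polynomial of degree r.  By
      (A1) they are unisolvent ([unisolvence]), so they separate coefficient
      vectors, and finite-dimensional norm equivalence, proved by Gaussian
      elimination ([separating_family_bound]), bounds the coefficients by the
      values of these functionals.
   2. Those values are end-point derivatives of the data and right-hand sides
      of the weak equations, bounded through (A2), (A3) and a Leibniz estimate
      ([data_bound]); this gives [reference_stability].
   3. The conditions on (a, b] pull back along T_n to the reference conditions
      ([pullback_conditions]) and the j-th derivative scales like ((b-a)/2)^j,
      which gives [local_stability] for one component.
   4. The vector-valued theorem follows componentwise, once (A2) and (A3) are
      reduced to scalar form.
   The file first develops finite sums, C^k calculus and univariate polynomials. *)

Require Import Defs.
From Stdlib Require Import Reals ZArith List Lra Lia FunctionalExtensionality.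
From Coquelicot Require Import Coquelicot.
Open Scope R_scope.

(* [psum n f] is f 0 + ... + f (n-1); unlike [sum_n] it allows empty sums and
   it unfolds by recursion, so the frozen [sumlt]/[sumle] are rewritten into it. *)
Fixpoint psum (n : nat) (f : nat -> R) : R :=
  match n with O => 0 | S n' => psum n' f + f n' end.

Lemma psum_shift n f : psum (S n) f = f O + psum n (fun i => f (S i)).
Proof. induction n; simpl in *. lra. rewrite IHn. lra. Qed.

Lemma psum_ext n f g : (forall i, (i < n)%nat -> f i = g i) -> psum n f = psum n g.
Proof.
  induction n; intros H; simpl. reflexivity.
  rewrite IHn by (intros; apply H; lia). rewrite H by lia. reflexivity.
Qed.

Lemma sumlt_psum n f : sumlt n f = psum n f.
Proof.
  unfold sumlt.
  assert (Hs : forall s, fold_right Rplus 0 (map f (seq s n)) = psum n (fun i => f (s + i)%nat)).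
  { induction n; intros s. reflexivity.
    simpl (seq s (S n)). simpl (map f _). simpl (fold_right _ _ _).
    rewrite IHn, psum_shift, Nat.add_0_r. f_equal.
    apply psum_ext. intros; f_equal; lia. }
  rewrite Hs. reflexivity.
Qed.

Lemma sumle_psum m f : sumle m f = psum (S m) f.
Proof. apply sumlt_psum. Qed.

Lemma psum_plus n f g : psum n (fun i => f i + g i) = psum n f + psum n g.
Proof. induction n; simpl. lra. rewrite IHn. lra. Qed.

Lemma psum_scal n c f : psum n (fun i => c * f i) = c * psum n f.
Proof. induction n; simpl. lra. rewrite IHn. lra. Qed.

Lemma psum_const n x : psum n (fun _ => x) = INR n * x.
Proof. induction n; simpl psum. simpl; ring. rewrite IHn, S_INR. ring. Qed.

Lemma psum_abs n f : Rabs (psum n f) <= psum n (fun i => Rabs (f i)).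
Proof.
  induction n; simpl. rewrite Rabs_R0; lra.
  eapply Rle_trans. apply Rabs_triang. lra.
Qed.

Lemma psum_le n f g : (forall i, (i < n)%nat -> f i <= g i) -> psum n f <= psum n g.
Proof.
  induction n; intros H; simpl. lra.
  assert (f n <= g n) by (apply H; lia).
  assert (psum n f <= psum n g) by (apply IHn; intros; apply H; lia). lra.
Qed.

Lemma psum_nonneg n f : (forall i, (i < n)%nat -> 0 <= f i) -> 0 <= psum n f.
Proof. intros H. rewrite <- (Rmult_0_r (INR n)), <- psum_const. apply psum_le; auto. Qed.

Lemma psum_term_le n f i0 :
  (i0 < n)%nat -> (forall i, (i < n)%nat -> 0 <= f i) -> f i0 <= psum n f.
Proof.
  induction n; intros Hi H; simpl. lia.
  assert (0 <= f n) by (apply H; lia).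
  destruct (Nat.eq_dec i0 n) as [->|Hne].
  - assert (0 <= psum n f) by (apply psum_nonneg; intros; apply H; lia). lra.
  - assert (f i0 <= psum n f) by (apply IHn; [lia | intros; apply H; lia]). lra.
Qed.

Lemma psum_single n f i0 :
  (i0 < n)%nat -> (forall i, (i < n)%nat -> i <> i0 -> f i = 0) -> psum n f = f i0.
Proof.
  induction n; intros Hi H. lia. simpl.
  destruct (Nat.eq_dec i0 n) as [->|Hne].
  - rewrite (psum_ext n f (fun _ => 0)) by (intros; apply H; lia).
    rewrite psum_const. ring.
  - rewrite IHn by (try lia; intros; apply H; lia). rewrite (H n) by lia. ring.
Qed.

Lemma Derive_n_Derive f j : Derive_n (Derive f) j = Derive_n f (S j).
Proof.
  apply functional_extensionality; intros x.
  change (Derive f) with (Derive_n f 1). rewrite Derive_n_comp. f_equal; lia.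
Qed.

Lemma Ck_S n f : Ck (S n) f <-> (forall x, ex_derive f x) /\ Ck n (Derive f).
Proof.
  unfold Ck. rewrite Derive_n_Derive. split.
  - intros [H1 H2]. split; [intros x; apply (H1 O x); lia |].
    split; auto. intros j x Hj. rewrite Derive_n_Derive. apply H1. lia.
  - intros [H1 [H2 H3]]. split; auto. intros [|j] x Hj; [apply H1 |].
    rewrite <- Derive_n_Derive. apply H2. lia.
Qed.

Lemma Ck_0 f : Ck 0 f <-> forall x, continuous f x.
Proof. unfold Ck. split; [intros [_ H]; exact H | intros H; split; [intros; lia | exact H]]. Qed.

Lemma ex_derive_continuous_R (f : R -> R) x : ex_derive f x -> continuous f x.
Proof. apply (ex_derive_continuous (K := R_AbsRing) (V := R_NormedModule)). Qed.

Lemma Ck_continuous n f : Ck n f -> forall x, continuous f x.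
Proof.
  destruct n; intros H x. exact (proj1 (Ck_0 f) H x).
  apply ex_derive_continuous_R. exact (proj1 (proj1 (Ck_S n f) H) x).
Qed.

Lemma Ck_Derive_n_continuous n f j :
  Ck n f -> (j <= n)%nat -> forall x, continuous (Derive_n f j) x.
Proof.
  intros [H1 H2] Hj x. destruct (Nat.eq_dec j n) as [->|Hne]; auto.
  apply ex_derive_continuous_R, H1. lia.
Qed.

Lemma Ck_le m n f : (m <= n)%nat -> Ck n f -> Ck m f.
Proof.
  intros Hmn [H1 H2]. split; [intros; apply H1; lia |].
  intros x. apply (Ck_Derive_n_continuous n); auto. split; auto.
Qed.

Lemma Ck_ext n f g : (forall x, f x = g x) -> Ck n f -> Ck n g.
Proof. intros H. replace g with f by (apply functional_extensionality; auto). auto. Qed.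

Lemma Ck_const n c : Ck n (fun _ => c).
Proof.
  revert c; induction n; intros c.
  - apply Ck_0; intros x. apply continuous_const.
  - apply Ck_S; split; [intros; apply ex_derive_const |].
    apply (Ck_ext _ (fun _ => 0)); [intros; rewrite Derive_const; auto | apply IHn].
Qed.

Lemma Ck_plus n f g : Ck n f -> Ck n g -> Ck n (fun x => f x + g x).
Proof.
  revert f g; induction n; intros f g Hf Hg.
  - apply Ck_0; intros x. apply (continuous_plus f g); eapply Ck_continuous; eauto.
  - apply Ck_S in Hf as [Hf1 Hf2]; apply Ck_S in Hg as [Hg1 Hg2].
    apply Ck_S; split; [intros x; exact (ex_derive_plus f g x (Hf1 x) (Hg1 x)) |].
    apply (Ck_ext _ (fun x => Derive f x + Derive g x)); [intros; rewrite Derive_plus; auto |].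
    apply IHn; auto.
Qed.

Lemma Ck_scal n c f : Ck n f -> Ck n (fun x => c * f x).
Proof.
  revert f; induction n; intros f Hf.
  - apply Ck_0; intros x. apply (continuous_scal_r c f). eapply Ck_continuous; eauto.
  - apply Ck_S in Hf as [Hf1 Hf2].
    apply Ck_S; split; [intros x; exact (ex_derive_scal f c x (Hf1 x)) |].
    apply (Ck_ext _ (fun x => c * Derive f x)); [intros; rewrite Derive_scal; auto |].
    apply IHn; auto.
Qed.

Lemma Ck_mult n f g : Ck n f -> Ck n g -> Ck n (fun x => f x * g x).
Proof.
  revert f g; induction n; intros f g Hf Hg.
  - apply Ck_0; intros x. apply (continuous_mult f g); eapply Ck_continuous; eauto.
  - pose proof (Ck_le n _ _ (le_S _ _ (le_n n)) Hf) as Hf'.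
    pose proof (Ck_le n _ _ (le_S _ _ (le_n n)) Hg) as Hg'.
    apply Ck_S in Hf as [Hf1 Hf2]; apply Ck_S in Hg as [Hg1 Hg2].
    apply Ck_S; split; [intros x; exact (ex_derive_mult f g x (Hf1 x) (Hg1 x)) |].
    apply (Ck_ext _ (fun x => Derive f x * g x + f x * Derive g x));
      [intros; rewrite Derive_mult; auto |].
    apply Ck_plus; apply IHn; auto.
Qed.

Lemma Ck_id n : Ck n (fun x => x).
Proof.
  destruct n. apply Ck_0; intros; apply continuous_id.
  apply Ck_S; split; [intros; apply ex_derive_id |].
  apply (Ck_ext _ (fun _ => 1)); [intros; symmetry; apply Derive_id | apply Ck_const].
Qed.

Lemma Ck_pow n j : Ck n (fun x => x ^ j).
Proof. induction j; simpl. apply Ck_const. apply Ck_mult; auto. apply Ck_id. Qed.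

Lemma Ck_psum n m (F : nat -> R -> R) :
  (forall i, (i < m)%nat -> Ck n (F i)) -> Ck n (fun x => psum m (fun i => F i x)).
Proof.
  induction m; intros H; simpl. apply Ck_const.
  apply Ck_plus; [apply IHm; intros; apply H | apply H]; lia.
Qed.

Lemma ex_derive_affine (be al x : R) : ex_derive (fun s => be + al * s) x.
Proof.
  apply (ex_derive_plus (fun _ => be) (fun s => al * s)).
  apply ex_derive_const. apply (ex_derive_scal (fun s => s)). apply ex_derive_id.
Qed.

Lemma Derive_affine (be al x : R) : Derive (fun s => be + al * s) x = al.
Proof.
  rewrite (Derive_plus (fun _ => be) (fun s => al * s)), Derive_const,
    (Derive_scal (fun s => s)), Derive_id; [ring | apply ex_derive_const |].
  apply (ex_derive_scal (fun s => s)). apply ex_derive_id.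
Qed.

Lemma Ck_comp_affine n be al f : Ck n f -> Ck n (fun s => f (be + al * s)).
Proof.
  revert f; induction n; intros f Hf.
  - apply Ck_0; intros x. apply (continuous_comp (fun s => be + al * s) f).
    + apply ex_derive_continuous_R, ex_derive_affine.
    + eapply Ck_continuous; eauto.
  - apply Ck_S in Hf as [Hf1 Hf2].
    apply Ck_S; split.
    + intros x. apply (ex_derive_comp f (fun s => be + al * s)); [apply Hf1 | apply ex_derive_affine].
    + apply (Ck_ext _ (fun x => al * Derive f (be + al * x))).
      { intros x. rewrite (Derive_comp f (fun s => be + al * s)), Derive_affine; auto.
        apply ex_derive_affine. }
      apply Ck_scal, IHn, Hf2.
Qed.

Definition smooth (f : R -> R) : Prop := forall n, Ck n f.

Lemma smooth_Derive f : smooth f -> smooth (Derive f).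
Proof. intros H n. exact (proj2 (proj1 (Ck_S n f) (H (S n)))). Qed.

Lemma smooth_ex_derive f x : smooth f -> ex_derive f x.
Proof. intros H. exact (proj1 (proj1 (Ck_S 0 f) (H 1%nat)) x). Qed.

Lemma smooth_mult f g : smooth f -> smooth g -> smooth (fun x => f x * g x).
Proof. intros Hf Hg n. apply Ck_mult; auto. Qed.

Lemma Ck_Derive_n_plus n f g : Ck n f -> Ck n g -> forall x,
  Derive_n (fun y => f y + g y) n x = Derive_n f n x + Derive_n g n x.
Proof.
  revert f g; induction n; intros f g Hf Hg x. reflexivity.
  apply Ck_S in Hf as [Hf1 Hf2]; apply Ck_S in Hg as [Hg1 Hg2].
  rewrite <- !Derive_n_Derive.
  rewrite (Derive_n_ext _ (fun y => Derive f y + Derive g y)) by (intros; apply Derive_plus; auto).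
  apply IHn; auto.
Qed.

Lemma Ck_Derive_n_psum n m (F : nat -> R -> R) : (forall i, (i < m)%nat -> Ck n (F i)) ->
  forall x, Derive_n (fun y => psum m (fun i => F i y)) n x = psum m (fun i => Derive_n (F i) n x).
Proof.
  induction m; intros H x; simpl.
  - destruct n; [reflexivity |]. apply Derive_n_const.
  - rewrite Ck_Derive_n_plus, IHm.
    + reflexivity.
    + intros; apply H; lia.
    + apply Ck_psum; intros; apply H; lia.
    + apply H; lia.
Qed.

Lemma Derive_n_comp_affine n be al f : Ck n f -> forall x,
  Derive_n (fun s => f (be + al * s)) n x = al ^ n * Derive_n f n (be + al * x).
Proof.
  revert f; induction n; intros f Hf x. simpl; ring.
  apply Ck_S in Hf as [Hf1 Hf2].
  rewrite <- !Derive_n_Derive.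
  rewrite (Derive_n_ext _ (fun s => al * Derive f (be + al * s))).
  - rewrite Derive_n_scal_l, IHn by auto. simpl; ring.
  - intros t. rewrite (Derive_comp f (fun s => be + al * s)), Derive_affine; auto.
    apply ex_derive_affine.
Qed.

Lemma Derive_n_mult_bound n f g x A B : Ck n f -> Ck n g ->
  (forall i, (i <= n)%nat -> Rabs (Derive_n f i x) <= A) ->
  (forall i, (i <= n)%nat -> Rabs (Derive_n g i x) <= B) ->
  Rabs (Derive_n (fun y => f y * g y) n x) <= 2 ^ n * A * B.
Proof.
  revert f g; induction n; intros f g Hf Hg HA HB.
  - simpl. rewrite Rabs_mult. specialize (HA O (le_n O)); specialize (HB O (le_n O)).
    simpl in HA, HB. pose proof (Rabs_pos (f x)). pose proof (Rabs_pos (g x)).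
    pose proof (Rmult_le_compat _ _ _ _ (Rabs_pos (f x)) (Rabs_pos (g x)) HA HB). lra.
  - pose proof (Ck_le n _ _ (le_S _ _ (le_n n)) Hf) as Hf'.
    pose proof (Ck_le n _ _ (le_S _ _ (le_n n)) Hg) as Hg'.
    apply Ck_S in Hf as [Hf1 Hf2]; apply Ck_S in Hg as [Hg1 Hg2].
    rewrite <- Derive_n_Derive.
    rewrite (Derive_n_ext _ (fun y => Derive f y * g y + f y * Derive g y))
      by (intros; apply Derive_mult; auto).
    rewrite Ck_Derive_n_plus by (apply Ck_mult; auto).
    assert (HA' : forall i, (i <= n)%nat -> Rabs (Derive_n (Derive f) i x) <= A)
      by (intros; rewrite Derive_n_Derive; apply HA; lia).
    assert (HB' : forall i, (i <= n)%nat -> Rabs (Derive_n (Derive g) i x) <= B)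
      by (intros; rewrite Derive_n_Derive; apply HB; lia).
    pose proof (IHn _ _ Hf2 Hg' HA' (fun i Hi => HB i (le_S _ _ Hi))).
    pose proof (IHn _ _ Hf' Hg2 (fun i Hi => HA i (le_S _ _ Hi)) HB').
    eapply Rle_trans; [apply Rabs_triang |]. simpl. lra.
Qed.

Lemma bound_extends_left (h : R -> R) a b M : a < b -> continuous h a ->
  (forall t, a < t <= b -> Rabs (h t) <= M) -> Rabs (h a) <= M.
Proof.
  intros Hab Hc H. apply Rnot_lt_le. intros Hlt.
  apply continuity_pt_filterlim in Hc.
  destruct (Hc (Rabs (h a) - M)) as [del [Hdel Hx]]; [lra |].
  set (t := a + Rmin (del / 2) (b - a)).
  assert (Hpos : 0 < Rmin (del / 2) (b - a)) by (apply Rmin_glb_lt; lra).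
  pose proof (Rmin_l (del / 2) (b - a)). pose proof (Rmin_r (del / 2) (b - a)).
  assert (Ht : a < t <= b) by (unfold t; lra).
  assert (Hd : Rabs (h t - h a) < Rabs (h a) - M).
  { apply Hx. split; [split; [exact I | unfold t; lra] |].
    simpl. unfold R_dist. rewrite Rabs_right; unfold t; lra. }
  specialize (H t Ht). pose proof (Rabs_triang_inv (h a) (h t)).
  rewrite <- Rabs_Ropp in Hd. replace (- (h t - h a)) with (h a - h t) in Hd by ring. lra.
Qed.

Lemma smooth_const_on f a b : smooth f -> (forall x, a <= x <= b -> Derive f x = 0) ->
  forall t, a <= t <= b -> f t = f a.
Proof.
  intros Hs HD t Ht. destruct (MVT_gen f a t (Derive f)) as [c [Hc Hmvt]].
  - intros x _. apply Derive_correct, smooth_ex_derive, Hs.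
  - intros x _. apply continuity_pt_filterlim, (Ck_continuous 0), Hs.
  - rewrite HD in Hmvt. lra.
    split; [apply Rle_trans with (Rmin a t) | apply Rle_trans with (Rmax a t)];
      try apply Hc; unfold Rmin, Rmax; destruct Rle_dec; lra.
Qed.

Definition peval (n : nat) (a : nat -> R) (t : R) : R := psum (S n) (fun j => a j * t ^ j).

Lemma is_poly_peval n f : is_poly n f <-> exists a, forall t, f t = peval n a t.
Proof.
  unfold is_poly, peval. split; intros [a H]; exists a; intros t; rewrite H, sumle_psum; auto.
Qed.

Lemma peval_S n a t : peval (S n) a t = a O + t * peval n (fun j => a (S j)) t.
Proof.
  unfold peval. rewrite (psum_shift (S n)), <- psum_scal. simpl (t ^ 0).
  rewrite Rmult_1_r. f_equal. apply psum_ext. intros; simpl; ring.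
Qed.

Lemma peval_smooth n a : smooth (peval n a).
Proof. intros m. apply (Ck_psum m (S n) (fun j t => a j * t ^ j)). intros; apply Ck_scal, Ck_pow. Qed.

Lemma poly_smooth n f : is_poly n f -> smooth f.
Proof.
  intros H m. apply is_poly_peval in H as [a Ha].
  apply (Ck_ext _ (peval n a)); [intros; auto | apply peval_smooth].
Qed.

Lemma poly_ext n f g : (forall t, f t = g t) -> is_poly n f -> is_poly n g.
Proof. intros H [a Ha]. exists a. intros t. rewrite <- H. auto. Qed.

Lemma poly_mono n m f : (n <= m)%nat -> is_poly n f -> is_poly m f.
Proof.
  intros Hnm H. apply is_poly_peval in H as [a Ha]. apply is_poly_peval.
  set (b := fun j => if Nat.leb j n then a j else 0).
  exists b. intros t. rewrite Ha. unfold peval.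
  induction Hnm as [|m Hnm IH].
  - apply psum_ext. intros i Hi. unfold b.
    replace (Nat.leb i n) with true by (symmetry; apply Nat.leb_le; lia). auto.
  - change (psum (S (S m)) (fun j => b j * t ^ j))
      with (psum (S m) (fun j => b j * t ^ j) + b (S m) * t ^ S m).
    rewrite <- IH. unfold b. replace (Nat.leb (S m) n) with false by (symmetry; apply Nat.leb_gt; lia).
    ring.
Qed.

Lemma poly_const n c : is_poly n (fun _ => c).
Proof.
  apply (poly_mono 0); [lia |]. apply is_poly_peval. exists (fun _ => c).
  intros; unfold peval; simpl; ring.
Qed.

Lemma poly_plus n f g : is_poly n f -> is_poly n g -> is_poly n (fun t => f t + g t).
Proof.
  intros Hf Hg. apply is_poly_peval in Hf as [a Ha]; apply is_poly_peval in Hg as [b Hb].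
  apply is_poly_peval. exists (fun j => a j + b j). intros t. rewrite Ha, Hb. unfold peval.
  rewrite <- psum_plus. apply psum_ext. intros; ring.
Qed.

Lemma poly_scal n c f : is_poly n f -> is_poly n (fun t => c * f t).
Proof.
  intros Hf. apply is_poly_peval in Hf as [a Ha].
  apply is_poly_peval. exists (fun j => c * a j). intros t. rewrite Ha. unfold peval.
  rewrite <- psum_scal. apply psum_ext. intros; ring.
Qed.

Lemma poly_psum n m (F : nat -> R -> R) : (forall i, (i < m)%nat -> is_poly n (F i)) ->
  is_poly n (fun t => psum m (fun i => F i t)).
Proof.
  induction m; intros H; simpl. apply poly_const.
  apply poly_plus; [apply IHm; intros; apply H | apply H]; lia.
Qed.

Lemma poly_horner n f : is_poly (S n) f -> exists c h, is_poly n h /\ forall t, f t = c + t * h t.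
Proof.
  intros H. apply is_poly_peval in H as [a Ha].
  exists (a O), (peval n (fun j => a (S j))). split.
  - apply is_poly_peval. exists (fun j => a (S j)); auto.
  - intros t. rewrite Ha. apply peval_S.
Qed.

Lemma poly_mul_x n h : is_poly n h -> is_poly (S n) (fun t => t * h t).
Proof.
  intros H. apply is_poly_peval in H as [a Ha]. apply is_poly_peval.
  exists (fun j => match j with O => 0 | S j' => a j' end). intros t.
  rewrite Ha, peval_S, Rplus_0_l. reflexivity.
Qed.

Lemma poly_mul_affine n be al h : is_poly n h -> is_poly (S n) (fun t => (be + al * t) * h t).
Proof.
  intros H. apply (poly_ext _ (fun t => be * h t + al * (t * h t))); [intros; ring |].
  apply poly_plus; apply poly_scal; [apply (poly_mono n); auto | apply poly_mul_x; auto].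
Qed.

Lemma poly_affine_pow j be al : is_poly j (fun t => (be + al * t) ^ j).
Proof. induction j. apply (poly_const 0 1). simpl. apply poly_mul_affine; auto. Qed.

Lemma poly_comp_affine n be al f : is_poly n f -> is_poly n (fun s => f (be + al * s)).
Proof.
  intros H. apply is_poly_peval in H as [a Ha].
  apply (poly_ext _ (fun s => psum (S n) (fun j => a j * (be + al * s) ^ j))); [intros; rewrite Ha; auto |].
  apply poly_psum. intros i Hi. apply poly_scal, (poly_mono i); [lia | apply poly_affine_pow].
Qed.

Lemma poly0_const f : is_poly 0 f -> forall t, f t = f 0.
Proof. intros [a Ha] t. rewrite !Ha. unfold sumle, sumlt. simpl. lra. Qed.

Lemma Derive_horner c h t : smooth h -> Derive (fun t => c + t * h t) t = h t + t * Derive h t.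
Proof.
  intros Hs. assert (Hh : ex_derive h t) by (apply smooth_ex_derive; auto).
  assert (Hid : ex_derive (fun t => t) t) by apply ex_derive_id.
  assert (Hm : ex_derive (fun t => t * h t) t) by exact (ex_derive_mult (fun t => t) h t Hid Hh).
  rewrite (Derive_plus (fun _ => c) (fun t => t * h t) t (ex_derive_const c t) Hm), Derive_const.
  rewrite Derive_mult, Derive_id by auto. ring.
Qed.

Lemma poly_deriv n f : is_poly n f -> is_poly (n - 1) (Derive f).
Proof.
  revert f; induction n as [|n IH]; intros f H.
  - apply (poly_ext _ (fun _ => 0)); [| apply poly_const].
    intros t. rewrite (Derive_ext _ (fun _ => f 0)) by (apply poly0_const; auto).
    symmetry; apply Derive_const.
  - destruct (poly_horner _ _ H) as [c [h [Hh Hf]]].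
    apply (poly_ext _ (fun t => h t + t * Derive h t)).
    { intros t. rewrite (Derive_ext f (fun t => c + t * h t)) by auto.
      symmetry; apply Derive_horner. eapply poly_smooth; eauto. }
    simpl. rewrite Nat.sub_0_r. apply poly_plus; [auto |].
    destruct n as [|n].
    + apply (poly_ext _ (fun _ => 0)); [| apply poly_const].
      intros t. specialize (IH h Hh). apply poly0_const with (t := t) in IH.
      rewrite IH. rewrite (Derive_ext _ (fun _ => h 0)) by (apply poly0_const; auto).
      rewrite Derive_const. ring.
    + replace (S n) with (S (S n - 1)) by lia. apply poly_mul_x, IH; auto.
Qed.

Lemma Derive_n_peval r a i x :
  Derive_n (peval r a) i x = psum (S r) (fun j => a j * Derive_n (fun t => t ^ j) i x).
Proof.
  unfold peval. rewrite (Ck_Derive_n_psum i (S r) (fun j t => a j * t ^ j)).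
  - apply psum_ext; intros. apply Derive_n_scal_l.
  - intros; apply Ck_scal, Ck_pow.
Qed.

(* A polynomial vanishing on [-1, 1] has zero coefficients: its Taylor
   coefficients at 0 only depend on its values near 0. *)
Lemma peval_coeffs_zero n a : (forall t, -1 <= t <= 1 -> peval n a t = 0) ->
  forall j, (j <= n)%nat -> a j = 0.
Proof.
  intros H j Hj.
  assert (Hloc : locally 0 (fun t => peval n a t = 0)).
  { exists (mkposreal 1 Rlt_0_1). intros t Ht. apply H.
    change (Rabs (t - 0) < 1) in Ht. apply Rabs_def2 in Ht. lra. }
  assert (Hd : Derive_n (peval n a) j 0 = 0).
  { rewrite (Derive_n_ext_loc _ (fun _ => 0) j 0 Hloc). destruct j; [reflexivity | apply Derive_n_const]. }
  rewrite Derive_n_peval, (psum_single _ _ j) in Hd; [| lia |].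
  2: { intros i Hi Hij. rewrite Derive_n_pow. destruct le_dec; [| ring].
       rewrite pow_i by lia. ring. }
  rewrite Derive_n_pow in Hd. destruct le_dec; [| lia].
  rewrite Nat.sub_diag, pow_O in Hd.
  assert (INR (fact j) <> 0) by apply INR_fact_neq_0.
  apply Rmult_integral in Hd as [Ha|Hf]; auto.
  exfalso. simpl in Hf. lra.
Qed.

Lemma poly_factor n f c : is_poly n f -> f c = 0 ->
  exists g, is_poly (pred n) g /\ forall t, f t = (t - c) * g t.
Proof.
  revert f; induction n; intros f Hf Hc.
  - exists (fun _ => 0). split; [apply poly_const |]. intros t.
    rewrite (poly0_const f Hf t), <- (poly0_const f Hf c), Hc. ring.
  - destruct (poly_horner _ _ Hf) as [c0 [h [Hh Hfh]]].
    destruct (IHn (fun t => h t + - h c)) as [g1 [Hg1 Hg1e]];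
      [apply poly_plus; auto; apply poly_const | lra |].
    exists (fun t => h t + c * g1 t). split.
    + simpl. apply poly_plus; auto. apply poly_scal, (poly_mono (pred n)); auto; lia.
    + intros t. rewrite Hfh. rewrite Hfh in Hc. specialize (Hg1e t).
      replace (h t) with (h c + (t - c) * g1 t) by lra.
      replace c0 with (- (c * h c)) by lra. ring.
Qed.

Lemma Derive_n_linear_factor c i : forall g, smooth g -> forall x,
  Derive_n (fun t => (t - c) * g t) (S i) x
  = (x - c) * Derive_n g (S i) x + INR (S i) * Derive_n g i x.
Proof.
  assert (Hlin : forall x, ex_derive (fun t => t - c) x /\ Derive (fun t => t - c) x = 1).
  { intros x. split.
    - apply (ex_derive_plus (fun t => t) (fun _ => - c)); [apply ex_derive_id | apply ex_derive_const].
    - rewrite (Derive_plus (fun t => t) (fun _ => - c)), Derive_id, Derive_const;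
        [ring | apply ex_derive_id | apply ex_derive_const]. }
  assert (Hstep : forall h, smooth h -> forall x,
    Derive (fun t => (t - c) * h t) x = h x + (x - c) * Derive h x).
  { intros h Hh x. destruct (Hlin x) as [Hl HDl].
    rewrite Derive_mult, HDl; [ring | auto | apply smooth_ex_derive; auto]. }
  induction i; intros g Hg x.
  - change (Derive (fun t => (t - c) * g t) x = (x - c) * Derive g x + INR 1 * g x).
    rewrite Hstep by auto. simpl. ring.
  - rewrite <- Derive_n_Derive.
    rewrite (Derive_n_ext _ (fun t => g t + (t - c) * Derive g t)) by (intros; apply Hstep; auto).
    assert (Hlin_smooth : smooth (fun t => t - c)).
    { intros m. apply (Ck_ext _ (fun t => t + - c)); [intros; ring |].
      apply Ck_plus; [apply Ck_id | apply Ck_const]. }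
    rewrite Ck_Derive_n_plus; [| apply Hg | apply smooth_mult; [| apply smooth_Derive]; auto].
    rewrite IHi by (apply smooth_Derive; auto).
    rewrite !Derive_n_Derive, !S_INR. ring.
Qed.

Lemma poly_root_multiplicity beta : forall n G h c, smooth G -> G c <> 0 -> is_poly n h ->
  (forall i, (i < beta)%nat -> Derive_n (fun t => G t * h t) i c = 0) ->
  exists psi, is_poly (n - beta) psi /\ forall t, h t = (t - c) ^ beta * psi t.
Proof.
  induction beta; intros n G h c HG HGc Hh Hd.
  - exists h. rewrite Nat.sub_0_r. split; auto. intros; simpl; ring.
  - assert (Hhc : h c = 0).
    { specialize (Hd O ltac:(lia)). simpl in Hd.
      apply Rmult_integral in Hd as [|]; [contradiction | auto]. }
    destruct (poly_factor n h c Hh Hhc) as [h1 [Hh1 Hh1e]].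
    destruct (IHbeta (pred n) G h1 c HG HGc Hh1) as [psi [Hpsi Hpsie]].
    + intros i Hi. specialize (Hd (S i) ltac:(lia)).
      rewrite (Derive_n_ext _ (fun t => (t - c) * (G t * h1 t))) in Hd by (intros; rewrite Hh1e; ring).
      rewrite Derive_n_linear_factor, Rminus_diag, Rmult_0_l, Rplus_0_l in Hd
        by (apply smooth_mult; [| eapply poly_smooth]; eauto).
      apply Rmult_integral in Hd as [Hi0|]; auto.
      exfalso; revert Hi0; apply not_0_INR; lia.
    + exists psi. split; [replace (n - S beta)%nat with (pred n - beta)%nat by lia; auto |].
      intros t. rewrite Hh1e, Hpsie. simpl. ring.
Qed.

Lemma monomial_derivative_bound p i s : -1 <= s <= 1 ->
  Rabs (Derive_n (fun t => t ^ p) i s) <= INR (fact p).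
Proof.
  intros Hs. pose proof (INR_fact_lt_0 p). rewrite Derive_n_pow. destruct le_dec.
  - rewrite Rabs_mult, <- RPow_abs. unfold Rdiv.
    rewrite Rabs_mult, (Rabs_pos_eq (INR (fact p))), Rabs_pos_eq by
      (try apply Rlt_le, Rinv_0_lt_compat, INR_fact_lt_0; lra).
    assert (Hf : 1 <= INR (fact (p - i))) by (apply (le_INR 1), lt_O_fact).
    assert (Hp : Rabs s ^ (p - i) <= 1).
    { rewrite <- (pow1 (p - i)). apply pow_incr. split; [apply Rabs_pos | apply Rabs_le; lra]. }
    assert (Hinv : / INR (fact (p - i)) <= 1) by (rewrite <- Rinv_1; apply Rinv_le_contravar; lra).
    assert (0 <= / INR (fact (p - i))) by (apply Rlt_le, Rinv_0_lt_compat; lra).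
    assert (0 <= Rabs s ^ (p - i)) by (apply pow_le, Rabs_pos).
    replace (INR (fact p)) with (INR (fact p) * 1 * 1) at 2 by ring.
    apply Rmult_le_compat; try nra.
  - rewrite Rabs_R0. lra.
Qed.

Definition dot (n : nat) (a g : nat -> R) : R := psum n (fun i => a i * g i).

Definition lsum (gs : list (nat -> R)) (F : (nat -> R) -> R) : R := fold_right Rplus 0 (map F gs).

Definition data_norm (gs : list (nat -> R)) (n : nat) (a : nat -> R) : R :=
  lsum gs (fun g => Rabs (dot n a g)).

Lemma lsum_le gs F G : (forall g, In g gs -> F g <= G g) -> lsum gs F <= lsum gs G.
Proof.
  induction gs as [|g gs IH]; intros H; unfold lsum in *; simpl. lra.
  assert (F g <= G g) by (apply H; left; auto).
  assert (fold_right Rplus 0 (map F gs) <= fold_right Rplus 0 (map G gs))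
    by (apply IH; intros; apply H; right; auto). lra.
Qed.

Lemma lsum_plus gs F G : lsum gs (fun g => F g + G g) = lsum gs F + lsum gs G.
Proof. induction gs; unfold lsum in *; simpl. lra. rewrite IHgs. lra. Qed.

Lemma lsum_scal gs c F : lsum gs (fun g => c * F g) = c * lsum gs F.
Proof. induction gs; unfold lsum in *; simpl. lra. rewrite IHgs. lra. Qed.

Lemma lsum_map gs h F : lsum (map h gs) F = lsum gs (fun g => F (h g)).
Proof. unfold lsum. rewrite map_map. reflexivity. Qed.

Lemma lsum_nonneg gs F : (forall g, In g gs -> 0 <= F g) -> 0 <= lsum gs F.
Proof.
  induction gs as [|g gs IH]; intros H; unfold lsum in *; simpl. lra.
  assert (0 <= F g) by (apply H; left; auto).
  assert (0 <= fold_right Rplus 0 (map F gs)) by (apply IH; intros; apply H; right; auto). lra.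
Qed.

Lemma lsum_term_le gs F g0 : In g0 gs -> (forall g, In g gs -> 0 <= F g) -> F g0 <= lsum gs F.
Proof.
  induction gs as [|g gs IH]; intros Hin H; [destruct Hin |]. unfold lsum; simpl.
  assert (0 <= F g) by (apply H; left; auto).
  assert (0 <= fold_right Rplus 0 (map F gs)) by (apply lsum_nonneg; intros; apply H; right; auto).
  destruct Hin as [->|Hin]; [lra |].
  assert (F g0 <= fold_right Rplus 0 (map F gs)) by (apply IH; auto; intros; apply H; right; auto).
  lra.
Qed.

Lemma lsum_bound gs F X : (forall g, In g gs -> F g <= X) -> lsum gs F <= INR (length gs) * X.
Proof.
  induction gs as [|g gs IH]; intros H; unfold lsum in *; simpl map; simpl fold_right.
  - simpl; lra.
  - rewrite length_cons, S_INR. assert (F g <= X) by (apply H; left; auto).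
    assert (fold_right Rplus 0 (map F gs) <= INR (length gs) * X) by (apply IH; intros; apply H; right; auto).
    lra.
Qed.

Lemma data_norm_nonneg gs n a : 0 <= data_norm gs n a.
Proof. apply lsum_nonneg; intros; apply Rabs_pos. Qed.

Lemma data_norm_term gs n a g : In g gs -> Rabs (dot n a g) <= data_norm gs n a.
Proof. intros Hg. apply (lsum_term_le gs (fun g => Rabs (dot n a g))); auto; intros; apply Rabs_pos. Qed.

Definition separates (n : nat) (gs : list (nat -> R)) : Prop :=
  forall a, (forall g, In g gs -> dot n a g = 0) -> forall i, (i < n)%nat -> a i = 0.

Lemma dot_S n a g : dot (S n) a g = dot n a g + a n * g n.
Proof. reflexivity. Qed.

Lemma dot_ext n a b g : (forall i, (i < n)%nat -> a i = b i) -> dot n a g = dot n b g.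
Proof. intros H. apply psum_ext. intros i Hi. rewrite H; auto. Qed.

Definition eliminate (n : nat) (g0 g : nat -> R) : nat -> R := fun i => g i - g0 i * (g n / g0 n).

Lemma dot_eliminate n a g0 g : g0 n <> 0 ->
  dot n a (eliminate n g0 g) = dot (S n) a g - g n / g0 n * dot (S n) a g0.
Proof.
  intros Hp. unfold dot, eliminate. simpl psum.
  rewrite (psum_ext n _ (fun i => a i * g i + (- (g n / g0 n)) * (a i * g0 i))) by (intros; ring).
  rewrite psum_plus, psum_scal. field. auto.
Qed.

Lemma pivot_exists n gs : separates (S n) gs -> exists g0, In g0 gs /\ g0 n <> 0.
Proof.
  intros Hinj.
  assert (Hdec : (forall g, In g gs -> g n = 0) \/ exists g0, In g0 gs /\ g0 n <> 0).
  { clear Hinj. induction gs as [|g gs IH]; [left; intros g [] |].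
    destruct (Req_dec (g n) 0) as [Hz|Hnz]; [| right; exists g; simpl; auto].
    destruct IH as [Hall|[g0 [Hin Hg0]]].
    - left. intros h [<-|Hh]; auto.
    - right. exists g0. simpl; auto. }
  destruct Hdec as [Hall|]; auto. exfalso.
  set (e := fun i => if Nat.eqb i n then 1 else 0).
  assert (He : e n = 0).
  { apply Hinj; [| lia]. intros g Hg. unfold dot.
    rewrite (psum_single _ _ n); [| lia |].
    - unfold e. rewrite Nat.eqb_refl, Hall by auto. ring.
    - intros i _ Hi. unfold e. apply Nat.eqb_neq in Hi. rewrite Hi. ring. }
  unfold e in He. rewrite Nat.eqb_refl in He. lra.
Qed.

Lemma eliminate_separates n gs g0 : In g0 gs -> g0 n <> 0 -> separates (S n) gs ->
  separates n (map (eliminate n g0) gs).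
Proof.
  intros Hg0 Hp Hsep a Ha i Hi.
  set (a' := fun j => if Nat.eqb j n then - dot n a g0 / g0 n else a j).
  assert (Hlow : forall j, (j < n)%nat -> a' j = a j).
  { intros j Hj. unfold a'. replace (Nat.eqb j n) with false by (symmetry; apply Nat.eqb_neq; lia). auto. }
  assert (Hpiv : dot (S n) a' g0 = 0).
  { rewrite dot_S, (dot_ext n a' a) by auto. unfold a'. rewrite Nat.eqb_refl. field. auto. }
  rewrite <- (Hlow i Hi). apply Hsep; [| lia]. intros g Hg.
  assert (He : dot n a (eliminate n g0 g) = 0) by (apply Ha, in_map; auto).
  rewrite <- (dot_ext n a' a), dot_eliminate, Hpiv in He by auto. lra.
Qed.

Lemma eliminate_data_norm n gs g0 a : In g0 gs -> g0 n <> 0 ->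
  data_norm (map (eliminate n g0) gs) n a
  <= (1 + lsum gs (fun g => Rabs (g n)) / Rabs (g0 n)) * data_norm gs (S n) a.
Proof.
  intros Hg0 Hp. unfold data_norm at 1. rewrite lsum_map.
  assert (Hpos : 0 < / Rabs (g0 n)) by (apply Rinv_0_lt_compat, Rabs_pos_lt; auto).
  eapply Rle_trans.
  - apply (lsum_le _ _ (fun g => Rabs (dot (S n) a g)
                                  + / Rabs (g0 n) * Rabs (dot (S n) a g0) * Rabs (g n))).
    intros g _. rewrite dot_eliminate by auto.
    eapply Rle_trans; [apply Rabs_triang |]. rewrite Rabs_Ropp.
    right. unfold Rdiv. rewrite !Rabs_mult, Rabs_inv. ring.
  - rewrite lsum_plus, lsum_scal. fold (data_norm gs (S n) a).
    pose proof (data_norm_term gs (S n) a g0 Hg0).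
    pose proof (lsum_nonneg gs (fun g => Rabs (g n)) (fun g _ => Rabs_pos (g n))).
    assert (0 <= / Rabs (g0 n) * lsum gs (fun g => Rabs (g n))) by (apply Rmult_le_pos; lra).
    unfold Rdiv. nra.
Qed.

Lemma last_coordinate_bound n a g0 B : g0 n <> 0 -> (forall i, (i < n)%nat -> Rabs (a i) <= B) ->
  Rabs (a n) <= (Rabs (dot (S n) a g0) + B * psum n (fun i => Rabs (g0 i))) / Rabs (g0 n).
Proof.
  intros Hp HB.
  assert (Hlow : Rabs (dot n a g0) <= B * psum n (fun i => Rabs (g0 i))).
  { unfold dot. eapply Rle_trans; [apply psum_abs |]. rewrite <- psum_scal.
    apply psum_le. intros i Hi. rewrite Rabs_mult.
    apply Rmult_le_compat_r; [apply Rabs_pos | auto]. }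
  replace (a n) with ((dot (S n) a g0 - dot n a g0) / g0 n) by (rewrite dot_S; field; auto).
  unfold Rdiv. rewrite Rabs_mult, Rabs_inv.
  apply Rmult_le_compat_r; [apply Rlt_le, Rinv_0_lt_compat, Rabs_pos_lt; auto |].
  eapply Rle_trans; [apply Rabs_triang | rewrite Rabs_Ropp; lra].
Qed.

Lemma separating_family_bound n : forall gs, separates n gs ->
  exists C, 0 <= C /\ forall a i, (i < n)%nat -> Rabs (a i) <= C * data_norm gs n a.
Proof.
  induction n as [|n IH]; intros gs Hsep; [exists 0; split; [lra | intros; lia] |].
  destruct (pivot_exists n gs Hsep) as [g0 [Hg0 Hp]].
  destruct (IH _ (eliminate_separates n gs g0 Hg0 Hp Hsep)) as [C' [HC' HC'b]].
  set (K := lsum gs (fun g => Rabs (g n)) / Rabs (g0 n)).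
  set (G := psum n (fun i => Rabs (g0 i))).
  assert (HK : 0 <= K).
  { apply Rmult_le_pos; [apply lsum_nonneg; intros; apply Rabs_pos |].
    apply Rlt_le, Rinv_0_lt_compat, Rabs_pos_lt; auto. }
  assert (HG : 0 <= G) by (apply psum_nonneg; intros; apply Rabs_pos).
  assert (Hinv : 0 < / Rabs (g0 n)) by (apply Rinv_0_lt_compat, Rabs_pos_lt; auto).
  set (Clow := C' * (1 + K)).
  assert (HClow : 0 <= Clow) by (apply Rmult_le_pos; lra).
  exists (Clow + (1 + Clow * G) / Rabs (g0 n)).
  split; [apply Rplus_le_le_0_compat; [lra | apply Rmult_le_pos; nra] |].
  intros a i Hi. pose proof (data_norm_nonneg gs (S n) a) as HN.
  assert (Hlow : forall j, (j < n)%nat -> Rabs (a j) <= Clow * data_norm gs (S n) a).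
  { intros j Hj. eapply Rle_trans; [apply HC'b; auto |].
    unfold Clow. rewrite Rmult_assoc. apply Rmult_le_compat_l; [auto | apply eliminate_data_norm; auto]. }
  assert (Htop : Rabs (a n) <= (1 + Clow * G) / Rabs (g0 n) * data_norm gs (S n) a).
  { eapply Rle_trans; [apply (last_coordinate_bound n a g0 _ Hp Hlow) |].
    pose proof (data_norm_term gs (S n) a g0 Hg0).
    assert (Rabs (dot (S n) a g0) + Clow * data_norm gs (S n) a * G <= (1 + Clow * G) * data_norm gs (S n) a)
      by nra.
    fold G. unfold Rdiv.
    apply Rle_trans with ((1 + Clow * G) * data_norm gs (S n) a * / Rabs (g0 n)); [| right; ring].
    apply Rmult_le_compat_r; lra. }
  assert (0 <= (1 + Clow * G) / Rabs (g0 n) * data_norm gs (S n) a) by (apply Rmult_le_pos; [apply Rmult_le_pos|]; nra).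
  destruct (Nat.eq_dec i n) as [->|Hne]; [nra |].
  specialize (Hlow i ltac:(lia)). nra.
Qed.

Section LinearFunctional.
Variables (kI : nat) (I : functional).
Hypothesis HI : lin_functional kI I.

Lemma lin_functional_zero : I (fun _ => 0) = 0.
Proof.
  pose proof (HI 0 0 (fun _ => 0) (fun _ => 0) (Ck_const _ _) (Ck_const _ _)) as H.
  cbv beta in H. rewrite (functional_extensionality (fun _ : R => 0 * 0 + 0 * 0) (fun _ => 0)) in H
    by (intros; ring). rewrite H. ring.
Qed.

Lemma lin_functional_scal c f : Ck kI f -> I (fun x => c * f x) = c * I f.
Proof.
  intros Hf. pose proof (HI c 0 f f Hf Hf) as H. cbv beta in H.
  rewrite (functional_extensionality (fun x => c * f x + 0 * f x) (fun x => c * f x)) in H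
    by (intros; ring). rewrite H. ring.
Qed.

Lemma lin_functional_psum M (c : nat -> R) (F : nat -> R -> R) :
  (forall j, (j < M)%nat -> Ck kI (F j)) ->
  I (fun s => psum M (fun j => c j * F j s)) = psum M (fun j => c j * I (F j)).
Proof.
  induction M; intros H; simpl. apply lin_functional_zero.
  pose proof (HI 1 (c M) (fun s => psum M (fun j => c j * F j s)) (F M)) as HL. cbv beta in HL.
  rewrite (functional_extensionality (fun s => psum M (fun j => c j * F j s) + c M * F M s)
     (fun x => 1 * psum M (fun j => c j * F j x) + c M * F M x)) by (intros; ring).
  rewrite HL, IHM; [ring | intros; apply H; lia | | apply H; lia].
  apply Ck_psum. intros; apply Ck_scal, H; lia.
Qed.

Lemma lin_functional_poly_test Q n c phi : smooth Q -> is_poly n phi ->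
  (forall m, (m <= n)%nat -> I (fun s => Q s * s ^ m) = c * (-1) ^ m) ->
  I (fun s => Q s * phi s) = c * phi (-1).
Proof.
  intros HQ Hphi Hm. apply is_poly_peval in Hphi as [b Hb].
  rewrite (functional_extensionality _ (fun s => psum (S n) (fun m => b m * (Q s * s ^ m)))).
  - rewrite lin_functional_psum by (intros; apply Ck_mult; [apply HQ | apply Ck_pow]).
    rewrite Hb. unfold peval. rewrite <- psum_scal. apply psum_ext.
    intros m Hm'. rewrite Hm by lia. ring.
  - intros s. rewrite Hb. unfold peval. rewrite <- psum_scal.
    apply psum_ext; intros; ring.
Qed.

End LinearFunctional.

(* On the reference interval [-1, 1], a derivative with k/2 zeros at 1 and
   (k-1)/2 zeros at -1 carries the weight of assumption (A1). *)
Lemma weighted_factorization r k Q : (1 <= k)%nat -> is_poly (r - 1) Q ->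
  (forall i, (i < k / 2)%nat -> Derive_n Q i 1 = 0) ->
  (forall i, (i < (k - 1) / 2)%nat -> Derive_n Q i (-1) = 0) ->
  exists psi, is_poly (r - k) psi /\
    forall t, Q t = (1 - t) ^ (k / 2) * (1 + t) ^ ((k - 1) / 2) * psi t.
Proof.
  intros Hk HQ HR HL.
  assert (Hsmooth_one : smooth (fun _ => 1)) by (intros n; apply Ck_const).
  destruct (poly_root_multiplicity (k / 2) (r - 1) (fun _ => 1) Q 1 Hsmooth_one ltac:(lra) HQ)
    as [psi1 [Hpsi1 HQe]].
  { intros i Hi. rewrite (Derive_n_ext _ Q) by (intros; ring). auto. }
  assert (Hweight : smooth (fun t => (t - 1) ^ (k / 2))).
  { apply (poly_smooth (k / 2)), (poly_ext _ (fun t => (-1 + 1 * t) ^ (k / 2))).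
    intros; f_equal; ring. apply poly_affine_pow. }
  destruct (poly_root_multiplicity ((k - 1) / 2) (r - 1 - k / 2) _ psi1 (-1) Hweight) as [psi0 [Hpsi0 Hpsi1e]].
  { apply pow_nonzero. lra. }
  { auto. }
  { intros i Hi. rewrite (Derive_n_ext _ Q) by (intros; rewrite HQe; auto). auto. }
  exists (fun t => (-1) ^ (k / 2) * psi0 t). split.
  - apply poly_scal. replace (r - k)%nat with (r - 1 - k / 2 - (k - 1) / 2)%nat; auto.
    pose proof (Nat.div_mod_eq k 2). pose proof (Nat.mod_upper_bound k 2).
    pose proof (Nat.div_mod_eq (k - 1) 2). pose proof (Nat.mod_upper_bound (k - 1) 2). lia.
  - intros t. rewrite HQe, Hpsi1e. replace (t - -1) with (1 + t) by ring.
    replace (t - 1) with (-1 * (1 - t)) by ring. rewrite Rpow_mult_distr. ring.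
Qed.

Lemma poly_zero_on_interval n f : is_poly n f -> (forall t, -1 <= t <= 1 -> f t = 0) ->
  forall t, f t = 0.
Proof.
  intros Hf H t. apply is_poly_peval in Hf as [a Ha].
  assert (Hc : forall j, (j <= n)%nat -> a j = 0)
    by (apply peval_coeffs_zero; intros s Hs; rewrite <- Ha; auto).
  rewrite Ha. unfold peval. rewrite (psum_ext _ _ (fun _ => 0)), psum_const; [ring |].
  intros j Hj. rewrite Hc by lia. ring.
Qed.

Lemma unisolvence_k0 r kI I q : lin_functional kI I -> AssumptionA1 r 0 I -> is_poly r q ->
  (forall m, (m <= r)%nat -> I (fun s => Derive q s * s ^ m) + q (-1) * (-1) ^ m = 0) ->
  (forall t, Derive q t = 0) /\ q (-1) = 0.
Proof.
  intros HI HA1 Hq Hweak.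
  assert (HQ : is_poly (r - 1) (Derive q)) by (apply poly_deriv; auto).
  assert (HQs : smooth (Derive q)) by (apply smooth_Derive, (poly_smooth r); auto).
  assert (HQ0 : forall t, Derive q t = 0).
  { destruct (Nat.eq_dec r 0) as [->|Hr].
    - intros t. rewrite (Derive_ext _ (fun _ => q 0)) by (apply poly0_const; auto).
      apply Derive_const.
    - apply (poly_zero_on_interval (r - 1)); auto.
      apply (HA1 ltac:(simpl; lia) (Derive q)); [simpl; auto |].
      intros phi Hphi. simpl in Hphi |- *.
      rewrite (functional_extensionality _ (fun s => Derive q s * ((1 + 1 * s) * phi s)))
        by (intros; ring).
      rewrite (lin_functional_poly_test kI I HI _ r (- q (-1))); auto.
      + ring.
      + replace r with (S (r - 1)) by lia. apply poly_mul_affine; auto.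
      + intros m Hm. specialize (Hweak m Hm). lra. }
  split; auto.
  specialize (Hweak O (Nat.le_0_l r)).
  rewrite (functional_extensionality (fun s => Derive q s * s ^ 0) (fun _ => 0)) in Hweak
    by (intros; rewrite HQ0; ring).
  rewrite (lin_functional_zero kI I HI) in Hweak. simpl in Hweak. lra.
Qed.

(* Unisolvence for k >= 1: the end point conditions factor the weight of (A1)
   out of q', and the weak equations then annihilate the cofactor. *)
Lemma unisolvence_kpos r k kI I q : (1 <= k <= r)%nat -> lin_functional kI I ->
  AssumptionA1 r k I -> is_poly r q ->
  (forall i, (i <= (k - 1) / 2)%nat -> Derive_n q i (-1) = 0) ->
  (forall i, (1 <= i <= k / 2)%nat -> Derive_n q i 1 = 0) ->
  (forall m, (m <= r - k)%nat -> I (fun s => Derive q s * s ^ m) = 0) ->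
  (forall t, Derive q t = 0) /\ q (-1) = 0.
Proof.
  intros Hk HI HA1 Hq HL HR Hweak.
  assert (HQ : is_poly (r - 1) (Derive q)) by (apply poly_deriv; auto).
  assert (HQs : smooth (Derive q)) by (apply smooth_Derive, (poly_smooth r); auto).
  destruct (weighted_factorization r k (Derive q)) as [psi [Hpsi HQf]]; auto; try lia.
  { intros i Hi. rewrite Derive_n_Derive. apply HR. lia. }
  { intros i Hi. rewrite Derive_n_Derive. apply HL. lia. }
  split; [| apply (HL O); lia].
  apply (poly_zero_on_interval (r - 1)); auto. intros s Hs.
  rewrite HQf, (HA1 ltac:(lia) psi); [ring | rewrite Nat.max_r by lia; auto | | auto].
  intros phi Hphi. rewrite Nat.max_r in Hphi by lia.
  replace (Nat.eqb k 0) with false by (symmetry; apply Nat.eqb_neq; lia).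
  rewrite (functional_extensionality _ (fun s => Derive q s * phi s)) by (intros; rewrite HQf; ring).
  rewrite (lin_functional_poly_test kI I HI _ (r - k) 0); auto; [ring |].
  intros m Hm. rewrite Hweak by auto. ring.
Qed.

Lemma unisolvence r k kI I q : (k <= r)%nat -> lin_functional kI I -> AssumptionA1 r k I ->
  is_poly r q ->
  ((1 <= k)%nat -> forall i, (i <= (k - 1) / 2)%nat -> Derive_n q i (-1) = 0) ->
  ((2 <= k)%nat -> forall i, (1 <= i <= k / 2)%nat -> Derive_n q i 1 = 0) ->
  (forall m, (m <= r - k)%nat ->
     I (fun s => Derive q s * s ^ m) + kron0 k * (q (-1) * (-1) ^ m) = 0) ->
  forall t, -1 <= t <= 1 -> q t = 0.
Proof.
  intros Hkr HI HA1 Hq HL HR Hweak.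
  assert (Hflat : (forall t, Derive q t = 0) /\ q (-1) = 0).
  { destruct (Nat.eq_dec k 0) as [->|Hk].
    - apply (unisolvence_k0 r kI I); auto. intros m Hm.
      rewrite <- (Hweak m) by lia. unfold kron0; simpl; ring.
    - apply (unisolvence_kpos r k kI I); [lia | auto | auto | auto | | |].
      + intros i Hi. apply HL; [lia | auto].
      + intros i Hi. apply HR; [| auto].
        pose proof (Nat.div_mod_eq k 2). pose proof (Nat.mod_upper_bound k 2). lia.
      + intros m Hm. rewrite <- (Hweak m Hm). unfold kron0.
        replace (Nat.eqb k 0) with false by (symmetry; apply Nat.eqb_neq; lia). ring. }
  destruct Hflat as [HQ0 Hqm1]. intros t Ht.
  rewrite (smooth_const_on q (-1) 1) by (auto; eapply poly_smooth; eauto). auto.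
Qed.

(* The defining conditions of the operator, as linear functionals on the
   coefficient vector a of a reference polynomial peval r a. *)
Definition left_vec (i : nat) : nat -> R := fun j => Derive_n (fun t => t ^ j) i (-1).
Definition right_vec (i : nat) : nat -> R := fun j => Derive_n (fun t => t ^ j) i 1.
Definition weak_vec (k : nat) (I : functional) (m : nat) : nat -> R :=
  fun j => I (fun s => Derive (fun t => t ^ j) s * s ^ m) + kron0 k * ((-1) ^ j * (-1) ^ m).

Definition left_range (k : nat) : list nat := if Nat.leb 1 k then seq 0 (S ((k - 1) / 2)) else nil.
Definition right_range (k : nat) : list nat := if Nat.leb 2 k then seq 1 (k / 2) else nil.

Definition data_vectors (r k : nat) (I : functional) : list (nat -> R) :=
  map left_vec (left_range k) ++ map right_vec (right_range k)
  ++ map (weak_vec k I) (seq 0 (S (r - k))).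

Lemma in_left_range k i : In i (left_range k) <-> (1 <= k)%nat /\ (i <= (k - 1) / 2)%nat.
Proof.
  unfold left_range. destruct (Nat.leb_spec 1 k); rewrite ?in_seq; simpl; split; lia.
Qed.

Lemma in_right_range k i : In i (right_range k) <-> (2 <= k)%nat /\ (1 <= i <= k / 2)%nat.
Proof.
  unfold right_range. destruct (Nat.leb_spec 2 k); rewrite ?in_seq; simpl; split; lia.
Qed.

Lemma data_vectors_cases r k I g : In g (data_vectors r k I) ->
  (exists i, In i (left_range k) /\ g = left_vec i) \/
  (exists i, In i (right_range k) /\ g = right_vec i) \/
  (exists m, (m <= r - k)%nat /\ g = weak_vec k I m).
Proof.
  unfold data_vectors. rewrite !in_app_iff, !in_map_iff.
  intros [[i [<- Hi]]|[[i [<- Hi]]|[m [<- Hm]]]]; eauto.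
  right; right. exists m. rewrite in_seq in Hm. split; [lia | auto].
Qed.

Lemma dot_left_vec r a i : dot (S r) a (left_vec i) = Derive_n (peval r a) i (-1).
Proof. rewrite Derive_n_peval. reflexivity. Qed.

Lemma dot_right_vec r a i : dot (S r) a (right_vec i) = Derive_n (peval r a) i 1.
Proof. rewrite Derive_n_peval. reflexivity. Qed.

Lemma dot_weak_vec r k kI I a m : lin_functional kI I ->
  dot (S r) a (weak_vec k I m)
  = I (fun s => Derive (peval r a) s * s ^ m) + kron0 k * (peval r a (-1) * (-1) ^ m).
Proof.
  intros HI.
  rewrite (functional_extensionality (fun s => Derive (peval r a) s * s ^ m)
    (fun s => psum (S r) (fun j => a j * (Derive (fun t => t ^ j) s * s ^ m)))).
  - rewrite (lin_functional_psum kI I HI).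
    + unfold dot, weak_vec, peval.
      rewrite (Rmult_comm (psum _ _)), <- Rmult_assoc, <- psum_scal, <- psum_plus.
      apply psum_ext. intros; ring.
    + intros j _. apply Ck_mult; [| apply Ck_pow].
      exact (proj2 (proj1 (Ck_S kI _) (Ck_pow (S kI) j))).
  - intros s. change (Derive (peval r a) s) with (Derive_n (peval r a) 1 s).
    rewrite Derive_n_peval, Rmult_comm, <- psum_scal. apply psum_ext. intros; simpl; ring.
Qed.

Lemma data_vectors_separate r k kI I : (k <= r)%nat -> lin_functional kI I -> AssumptionA1 r k I ->
  separates (S r) (data_vectors r k I).
Proof.
  intros Hkr HI HA1 a Hin j Hj.
  apply (peval_coeffs_zero r a); [| lia].
  apply (unisolvence r k kI I); auto.
  - apply is_poly_peval. exists a; auto.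
  - intros Hk i Hi. rewrite <- dot_left_vec. apply Hin.
    unfold data_vectors. apply in_or_app; left. apply in_map, in_left_range; auto.
  - intros Hk i Hi. rewrite <- dot_right_vec. apply Hin.
    unfold data_vectors. apply in_or_app; right; apply in_or_app; left.
    apply in_map, in_right_range; auto.
  - intros m Hm. rewrite <- (dot_weak_vec r k kI I a m HI). apply Hin.
    unfold data_vectors. apply in_or_app; right; apply in_or_app; right.
    apply in_map, in_seq. lia.
Qed.

Definition scalar_A2 (kI : nat) (I : functional) (C0 : R) : Prop :=
  forall h, Ck kI h -> forall beta,
    (forall j s, (j <= kI)%nat -> -1 <= s <= 1 -> Rabs (Derive_n h j s) <= beta) ->
    Rabs (I h) <= C0 * beta.

Definition scalar_A3 (kI kO : nat) (O : operator) (C1 : R) : Prop :=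
  forall l, (l <= kI)%nat -> forall h, Ck (Nat.max kO l) h -> forall beta,
    (forall j s, (j <= Nat.max kO l)%nat -> -1 <= s <= 1 -> Rabs (Derive_n h j s) <= beta) ->
    forall s, -1 <= s <= 1 -> Rabs (Derive_n (O h) l s) <= C1 * beta.

Definition ref_conditions (r k : nat) (I : functional) (O : operator) (w p : R -> R) : Prop :=
  ((1 <= k)%nat -> forall i, (i <= (k - 1) / 2)%nat -> Derive_n p i (-1) = Derive_n w i (-1)) /\
  ((2 <= k)%nat -> forall i, (1 <= i <= k / 2)%nat -> Derive_n p i 1 = Derive_n w i 1) /\
  (forall m, (m <= r - k)%nat ->
     I (fun s => Derive p s * s ^ m) + kron0 k * (p (-1) * (-1) ^ m)
     = I (fun s => O (Derive w) s * s ^ m) + kron0 k * (w (-1) * (-1) ^ m)).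

(* kJ + 1 covers the end-point derivatives, and kJ the orders needed by (A2), (A3). *)
Lemma kJ_bounds k kI kO : (k / 2 <= kJ k kI kO + 1)%nat /\ ((k - 1) / 2 <= k / 2)%nat /\
  (Nat.max kO kI <= kJ k kI kO)%nat.
Proof.
  unfold kJ. pose proof (Nat.div_mod_eq k 2). pose proof (Nat.mod_upper_bound k 2).
  pose proof (Nat.div_mod_eq (k - 1) 2). pose proof (Nat.mod_upper_bound (k - 1) 2). lia.
Qed.

Section ReferenceStability.
Variables (r k kI kO : nat) (I : functional) (O : operator) (C0 C1 : R).
Hypothesis Hkr : (k <= r)%nat.
Hypothesis HI : lin_functional kI I.
Hypothesis Hsm : smoothing kO O.
Hypothesis HA1 : AssumptionA1 r k I.
Hypothesis HC0 : 0 <= C0.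
Hypothesis HC1 : 0 <= C1.
Hypothesis HA2 : scalar_A2 kI I C0.
Hypothesis HA3 : scalar_A3 kI kO O C1.

Definition bounded_data (w : R -> R) (beta : R) : Prop :=
  Ck (kJ k kI kO + 1) w /\
  forall j s, (j <= kJ k kI kO + 1)%nat -> -1 <= s <= 1 -> Rabs (Derive_n w j s) <= beta.

(* Right-hand side of the weak equations: (A3) controls O w' and its derivatives,
   the Leibniz estimate the product with s^m, and (A2) the functional. *)
Lemma weak_rhs_bound w beta m : bounded_data w beta -> (m <= r)%nat ->
  Rabs (I (fun s => O (Derive w) s * s ^ m)) <= C0 * (2 ^ kI * C1 * INR (fact r)) * beta.
Proof.
  intros [Hw HB] Hm. destruct (kJ_bounds k kI kO) as [_ [_ HkJ]].
  assert (HDw : Ck (Nat.max kO kI) (Derive w)).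
  { apply (Ck_le _ (kJ k kI kO)); [auto |]. rewrite Nat.add_1_r in Hw. apply Ck_S in Hw. apply Hw. }
  assert (HOw : forall i s, (i <= kI)%nat -> -1 <= s <= 1 -> Rabs (Derive_n (O (Derive w)) i s) <= C1 * beta).
  { intros i s Hi Hs. apply HA3; auto.
    - apply (Ck_le _ (Nat.max kO kI)); [lia | auto].
    - intros j s' Hj Hs'. rewrite Derive_n_Derive. apply HB; [lia | auto]. }
  assert (HC1b : 0 <= C1 * beta) by (eapply Rle_trans; [apply Rabs_pos | apply (HOw 0%nat (-1)); lia || lra]).
  apply Rle_trans with (C0 * (2 ^ kI * (C1 * beta) * INR (fact r))); [| right; ring].
  apply HA2.
  - apply Ck_mult; [apply Hsm, HDw | apply Ck_pow].
  - intros j s Hj Hs. eapply Rle_trans.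
    + apply (Derive_n_mult_bound j _ _ s (C1 * beta) (INR (fact r))).
      * apply (Ck_le _ kI); [auto | apply Hsm, HDw].
      * apply Ck_pow.
      * intros i Hi. apply HOw; [lia | auto].
      * intros i Hi. eapply Rle_trans; [apply monomial_derivative_bound; auto |].
        apply le_INR, fact_le; auto.
    + pose proof (INR_fact_lt_0 r).
      apply Rmult_le_compat_r; [lra |]. apply Rmult_le_compat_r; [auto |].
      apply Rle_pow; [lra | auto].
Qed.

Lemma data_bound w a beta : bounded_data w beta -> ref_conditions r k I O w (peval r a) ->
  forall g, In g (data_vectors r k I) ->
  Rabs (dot (S r) a g) <= (1 + C0 * (2 ^ kI * C1 * INR (fact r))) * beta.
Proof.
  intros Hw [HL [HR Hweak]] g Hg. pose proof Hw as [_ HB].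
  destruct (kJ_bounds k kI kO) as [Hk2 [Hk12 _]].
  assert (HX : 0 <= C0 * (2 ^ kI * C1 * INR (fact r)) * beta)
    by (eapply Rle_trans; [apply Rabs_pos | apply (weak_rhs_bound w beta 0%nat Hw); lia]).
  apply data_vectors_cases in Hg as [[i [Hi ->]]|[[i [Hi ->]]|[m [Hm ->]]]].
  - apply in_left_range in Hi as [Hk Hi].
    rewrite dot_left_vec, HL by auto. eapply Rle_trans; [apply HB; [lia | lra] | lra].
  - apply in_right_range in Hi as [Hk Hi].
    rewrite dot_right_vec, HR by auto. eapply Rle_trans; [apply HB; [lia | lra] | lra].
  - rewrite (dot_weak_vec r k kI I a m HI), Hweak by auto.
    eapply Rle_trans; [apply Rabs_triang |].
    assert (Hjump : Rabs (kron0 k * (w (-1) * (-1) ^ m)) <= beta).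
    { rewrite !Rabs_mult, pow_1_abs, Rmult_1_r.
      assert (Hk : 0 <= Rabs (kron0 k) <= 1)
        by (unfold kron0; destruct Nat.eqb; rewrite ?Rabs_R1, ?Rabs_R0; lra).
      assert (Hw0 : Rabs (w (-1)) <= beta) by exact (HB 0%nat (-1) ltac:(lia) ltac:(lra)).
      pose proof (Rabs_pos (w (-1))). nra. }
    pose proof (weak_rhs_bound w beta m Hw ltac:(lia)). lra.
Qed.

Lemma reference_stability l : exists K, 0 <= K /\
  forall w p beta, bounded_data w beta -> is_poly r p -> ref_conditions r k I O w p ->
  forall s, -1 <= s <= 1 -> Rabs (Derive_n p l s) <= K * beta.
Proof.
  destruct (separating_family_bound (S r) (data_vectors r k I)) as [C [HC HCb]].
  { apply (data_vectors_separate r k kI); auto. }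
  set (Kd := 1 + C0 * (2 ^ kI * C1 * INR (fact r))).
  set (Kc := C * (INR (length (data_vectors r k I)) * Kd)).
  exists (INR (S r) * Kc * INR (fact r)). split.
  { pose proof (pow_le 2 kI ltac:(lra)). pose proof (pos_INR (fact r)).
    pose proof (pos_INR (length (data_vectors r k I))). pose proof (pos_INR (S r)).
    assert (0 <= Kd) by (unfold Kd; repeat (apply Rmult_le_pos || apply Rplus_le_le_0_compat); lra).
    unfold Kc. repeat apply Rmult_le_pos; lra. }
  intros w p beta Hw Hp HJ s Hs.
  apply is_poly_peval in Hp as [a Ha].
  replace p with (peval r a) in * by (symmetry; apply functional_extensionality; auto).
  assert (Hcoef : forall j, (j < S r)%nat -> Rabs (a j) <= Kc * beta).
  { intros j Hj. eapply Rle_trans; [apply HCb; auto |]. unfold Kc. rewrite !Rmult_assoc.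
    apply Rmult_le_compat_l; [auto |]. unfold data_norm.
    apply lsum_bound. intros g Hg. apply (data_bound w); auto. }
  rewrite Derive_n_peval. eapply Rle_trans; [apply psum_abs |].
  apply Rle_trans with (psum (S r) (fun _ => Kc * beta * INR (fact r))).
  - apply psum_le. intros j Hj. rewrite Rabs_mult. apply Rmult_le_compat; try apply Rabs_pos; auto.
    eapply Rle_trans; [apply monomial_derivative_bound; auto | apply le_INR, fact_le; lia].
  - rewrite psum_const. right; ring.
Qed.

End ReferenceStability.

(* The defining conditions on (a, b] for one component, with the weak equations
   tested against the monomials Tinv^m, which span P_{r-k}. *)
Definition local_conditions (r k : nat) (I : functional) (O : operator) (a b : R)
  (v q : R -> R) : Prop :=
  ((1 <= k)%nat -> forall i, (i <= (k - 1) / 2)%nat -> Derive_n q i a = Derive_n v i a) /\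
  ((2 <= k)%nat -> forall i, (1 <= i <= k / 2)%nat -> Derive_n q i b = Derive_n v i b) /\
  (forall m, (m <= r - k)%nat ->
     locI I a b (fun t => Derive q t * Tinv a b t ^ m) + kron0 k * (q a * Tinv a b a ^ m)
     = locI I a b (fun t => locO O a b (Derive v) t * Tinv a b t ^ m)
       + kron0 k * (v a * Tinv a b a ^ m)).

Lemma Tinv_Tn a b s : a < b -> Tinv a b (Defs.Tn a b s) = s.
Proof. intros Hab. unfold Tinv, Defs.Tn. field. lra. Qed.

Lemma Tinv_range a b s : a < b -> a <= s <= b -> -1 <= Tinv a b s <= 1.
Proof.
  intros Hab Hs. assert (Hinv : 0 < / (b - a)) by (apply Rinv_0_lt_compat; lra).
  assert (H1 : 0 <= (s - a) / (b - a)) by (apply Rmult_le_pos; lra).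
  assert (H2 : 0 <= (b - s) / (b - a)) by (apply Rmult_le_pos; lra).
  assert (E1 : Tinv a b s = 2 * ((s - a) / (b - a)) - 1) by (unfold Tinv; field; lra).
  assert (E2 : Tinv a b s = 1 - 2 * ((b - s) / (b - a))) by (unfold Tinv; field; lra).
  lra.
Qed.

Lemma Tn_Tinv a b t : a < b -> Defs.Tn a b (Tinv a b t) = t.
Proof. intros Hab. unfold Tinv, Defs.Tn. field. lra. Qed.

Lemma Tn_range a b s : a < b -> -1 <= s <= 1 -> a <= Defs.Tn a b s <= b.
Proof. intros Hab Hs. unfold Defs.Tn. split; nra. Qed.

Lemma locI_pullback I a b f m : a < b ->
  locI I a b (fun t => f t * Tinv a b t ^ m) = (b - a) / 2 * I (fun s => f (Defs.Tn a b s) * s ^ m).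
Proof.
  intros Hab. unfold locI. f_equal. f_equal.
  apply functional_extensionality; intros s. rewrite Tinv_Tn; auto.
Qed.

Lemma locO_pullback (O : operator) a b f s : a < b ->
  locO O a b f (Defs.Tn a b s) = O (fun u => f (Defs.Tn a b u)) s.
Proof. intros Hab. unfold locO. rewrite Tinv_Tn; auto. Qed.

Lemma Derive_n_Tn n a b f : Ck n f -> forall s,
  Derive_n (fun u => f (Defs.Tn a b u)) n s = ((b - a) / 2) ^ n * Derive_n f n (Defs.Tn a b s).
Proof. intros Hf s. unfold Defs.Tn. apply Derive_n_comp_affine; auto. Qed.

Section PullBack.
Variables (r k kI kO : nat) (I : functional) (O : operator).
Hypothesis HI : lin_functional kI I.
Hypothesis HO : lin_operator kO O.
Hypothesis Hsm : smoothing kO O.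

(* The weak equations transform under T_n with the common factor (b - a)/2. *)
Lemma weak_equation_pullback a b v q m : a < b -> Ck (kJ k kI kO + 1) v -> smooth q ->
  locI I a b (fun t => Derive q t * Tinv a b t ^ m) + kron0 k * (q a * Tinv a b a ^ m)
  = locI I a b (fun t => locO O a b (Derive v) t * Tinv a b t ^ m) + kron0 k * (v a * Tinv a b a ^ m) ->
  I (fun s => Derive (fun u => q (Defs.Tn a b u)) s * s ^ m) + kron0 k * (q (Defs.Tn a b (-1)) * (-1) ^ m)
  = I (fun s => O (Derive (fun u => v (Defs.Tn a b u))) s * s ^ m) + kron0 k * (v (Defs.Tn a b (-1)) * (-1) ^ m).
Proof.
  intros Hab Hv Hq Hloc. destruct (kJ_bounds k kI kO) as [_ [_ HkJ]].
  set (al := (b - a) / 2). set (g := fun u => Derive v (Defs.Tn a b u)).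
  assert (Ha : Defs.Tn a b (-1) = a) by (unfold Defs.Tn; field).
  assert (HTa : Tinv a b a = -1) by (unfold Tinv; field; lra).
  assert (HDv : Ck (kJ k kI kO) (Derive v)).
  { rewrite Nat.add_1_r in Hv. apply Ck_S in Hv. apply Hv. }
  assert (Hg : Ck (Nat.max kO kI) g) by (apply Ck_comp_affine, (Ck_le _ (kJ k kI kO)); auto).
  assert (Hdq : forall s, Derive (fun u => q (Defs.Tn a b u)) s = al * Derive q (Defs.Tn a b s)).
  { intros s. rewrite <- (Rmult_1_r al). exact (Derive_n_Tn 1 a b q (Hq 1%nat) s). }
  assert (Hdv : forall s, Derive (fun u => v (Defs.Tn a b u)) s = al * g s).
  { intros s. rewrite <- (Rmult_1_r al). apply (Derive_n_Tn 1 a b v).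
    apply (Ck_le _ (kJ k kI kO + 1)); [lia | auto]. }
  assert (HOv : forall s, O (Derive (fun u => v (Defs.Tn a b u))) s = al * O g s).
  { intros s. rewrite (functional_extensionality (Derive (fun u => v (Defs.Tn a b u)))
      (fun y => al * g y + 0 * g y)) by (intros; rewrite Hdv; ring).
    rewrite HO by (apply (Ck_le _ (Nat.max kO kI)); [lia | auto]). ring. }
  rewrite !locI_pullback, HTa in Hloc by auto.
  rewrite (functional_extensionality (fun t => locO O a b (Derive v) (Defs.Tn a b t) * t ^ m)
    (fun t => O g t * t ^ m)) in Hloc by (intros; rewrite locO_pullback; auto).
  rewrite Ha, (functional_extensionality (fun s => Derive (fun u => q (Defs.Tn a b u)) s * s ^ m)
    (fun s => al * (Derive q (Defs.Tn a b s) * s ^ m))) by (intros; rewrite Hdq; ring).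
  rewrite (functional_extensionality (fun s => O (Derive (fun u => v (Defs.Tn a b u))) s * s ^ m)
    (fun s => al * (O g s * s ^ m))) by (intros; rewrite HOv; ring).
  rewrite !(lin_functional_scal kI I HI); [exact Hloc | |].
  - apply Ck_mult; [apply Hsm, Hg | apply Ck_pow].
  - apply Ck_mult; [apply Ck_comp_affine, smooth_Derive, Hq | apply Ck_pow].
Qed.


Lemma pullback_conditions a b v q : a < b -> Ck (kJ k kI kO + 1) v -> smooth q ->
  local_conditions r k I O a b v q ->
  ref_conditions r k I O (fun s => v (Defs.Tn a b s)) (fun s => q (Defs.Tn a b s)).
Proof.
  intros Hab Hv Hq [HL [HR Hweak]]. destruct (kJ_bounds k kI kO) as [Hk2 [Hk12 _]].
  assert (Hend : forall i x, (i <= k / 2)%nat -> Derive_n q i (Defs.Tn a b x) = Derive_n v i (Defs.Tn a b x) ->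
    Derive_n (fun s => q (Defs.Tn a b s)) i x = Derive_n (fun s => v (Defs.Tn a b s)) i x).
  { intros i x Hi He. rewrite !Derive_n_Tn, He; auto. apply (Ck_le _ (kJ k kI kO + 1)); [lia | auto]. }
  assert (Ha : Defs.Tn a b (-1) = a) by (unfold Defs.Tn; field).
  assert (Hb : Defs.Tn a b 1 = b) by (unfold Defs.Tn; field).
  split; [| split].
  - intros Hk i Hi. apply Hend; [lia |]. rewrite Ha. auto.
  - intros Hk i Hi. apply Hend; [lia |]. rewrite Hb. auto.
  - intros m Hm. apply weak_equation_pullback; auto.
Qed.

End PullBack.

Lemma pullback_data_bound k kI kO a b v M : a < b -> Ck (kJ k kI kO + 1) v ->
  (forall j s, (j <= kJ k kI kO + 1)%nat -> a < s <= b -> Rabs (Derive_n v j s) <= M j) ->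
  bounded_data k kI kO (fun s => v (Defs.Tn a b s))
    (sumle (kJ k kI kO + 1) (fun j => ((b - a) / 2) ^ j * M j)).
Proof.
  intros Hab Hv HM. set (n := (kJ k kI kO + 1)%nat).
  assert (Hal : 0 <= (b - a) / 2) by lra.
  assert (HMc : forall j s, (j <= n)%nat -> a <= s <= b -> Rabs (Derive_n v j s) <= M j).
  { intros j s Hj Hs. destruct (Req_dec s a) as [->|Hne]; [| apply HM; [auto | lra]].
    apply (bound_extends_left _ a b); [auto | apply (Ck_Derive_n_continuous n); auto |].
    intros t Ht. apply HM; auto. }
  split; [apply Ck_comp_affine; auto |].
  intros j s Hj Hs. rewrite Derive_n_Tn by (apply (Ck_le _ n); auto).
  rewrite Rabs_mult, (Rabs_pos_eq (_ ^ j)) by (apply pow_le; auto).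
  eapply Rle_trans; [apply Rmult_le_compat_l; [apply pow_le; auto | apply HMc; [auto | apply Tn_range; auto]] |].
  rewrite sumle_psum. apply (psum_term_le (S n) (fun j => ((b - a) / 2) ^ j * M j)); [lia |].
  intros i Hi. apply Rmult_le_pos; [apply pow_le; auto |].
  eapply Rle_trans; [apply Rabs_pos | apply (HMc i b); lia || lra].
Qed.

Lemma Derive_n_from_reference a b q l s : a < b -> smooth q ->
  Derive_n q l s = (/ ((b - a) / 2)) ^ l * Derive_n (fun u => q (Defs.Tn a b u)) l (Tinv a b s).
Proof.
  intros Hab Hq.
  assert (Hinv : forall t, Tinv a b t = - (b + a) / (b - a) + 2 / (b - a) * t)
    by (intros; unfold Tinv; field; lra).
  rewrite (Derive_n_ext q (fun t => (fun u => q (Defs.Tn a b u)) (- (b + a) / (b - a) + 2 / (b - a) * t))).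
  - rewrite (Derive_n_comp_affine l _ _ (fun u => q (Defs.Tn a b u))), Hinv;
      [f_equal; f_equal; field; lra |].
    apply Ck_comp_affine, Hq.
  - intros t. rewrite <- Hinv, Tn_Tinv; auto.
Qed.

Lemma powerRZ_rescale al n l (M : nat -> R) : 0 < al ->
  (/ al) ^ l * sumle n (fun j => al ^ j * M j)
  = sumle n (fun j => powerRZ al (Z.of_nat j - Z.of_nat l) * M j).
Proof.
  intros Hal. rewrite !sumle_psum, <- psum_scal. apply psum_ext. intros j _.
  unfold Z.sub. rewrite powerRZ_add, powerRZ_neg', <- !pow_powerRZ, pow_inv by lra. ring.
Qed.

Lemma local_stability r k kI kO I O C0 C1 l : (k <= r)%nat -> lin_functional kI I ->
  lin_operator kO O -> smoothing kO O -> AssumptionA1 r k I -> 0 <= C0 -> 0 <= C1 ->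
  scalar_A2 kI I C0 -> scalar_A3 kI kO O C1 ->
  exists K, 0 <= K /\ forall a b v q M, a < b -> Ck (kJ k kI kO + 1) v -> is_poly r q ->
    local_conditions r k I O a b v q ->
    (forall j s, (j <= kJ k kI kO + 1)%nat -> a < s <= b -> Rabs (Derive_n v j s) <= M j) ->
    forall s, a < s <= b ->
      Rabs (Derive_n q l s)
      <= K * sumle (kJ k kI kO + 1) (fun j => powerRZ ((b - a) / 2) (Z.of_nat j - Z.of_nat l) * M j).
Proof.
  intros Hkr HI HO Hsm HA1 HC0 HC1 HA2 HA3.
  destruct (reference_stability r k kI kO I O C0 C1 Hkr HI Hsm HA1 HC0 HC1 HA2 HA3 l) as [K [HK HKb]].
  exists K. split; [auto |]. intros a b v q M Hab Hv Hq Hloc HM s Hs.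
  assert (Hqs : smooth q) by (eapply poly_smooth; eauto).
  assert (Hal : 0 < (b - a) / 2) by lra.
  rewrite <- powerRZ_rescale by auto. rewrite (Derive_n_from_reference a b) by auto.
  rewrite Rabs_mult, Rabs_pos_eq by (apply pow_le, Rlt_le, Rinv_0_lt_compat; auto).
  rewrite (Rmult_comm K), Rmult_assoc. apply Rmult_le_compat_l; [apply pow_le, Rlt_le, Rinv_0_lt_compat; auto |].
  rewrite Rmult_comm. apply (HKb (fun u => v (Defs.Tn a b u))).
  - apply pullback_data_bound; auto.
  - apply poly_comp_affine; auto.
  - apply (pullback_conditions r k kI kO); auto.
  - apply Tinv_range; lra.
Qed.

Lemma enorm_const d x : enorm d (fun _ => x) = sqrt (INR d) * Rabs x.
Proof.
  unfold enorm. rewrite sumlt_psum, psum_const, sqrt_mult_alt by apply pos_INR.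
  f_equal. rewrite <- sqrt_Rsqr_abs. f_equal. unfold Rsqr; ring.
Qed.

Lemma enorm_component d x c : (c < d)%nat -> Rabs (x c) <= enorm d x.
Proof.
  intros Hc. unfold enorm. rewrite sumlt_psum, <- (sqrt_Rsqr_abs (x c)). apply sqrt_le_1_alt.
  replace (Rsqr (x c)) with ((fun i => x i ^ 2) c) by (unfold Rsqr; simpl; ring).
  apply (psum_term_le d (fun i => x i ^ 2) c); auto. intros; apply pow2_ge_0.
Qed.

Lemma enorm_bound d x B : (forall c, (c < d)%nat -> Rabs (x c) <= B) -> enorm d x <= sqrt (INR d) * B.
Proof.
  intros H. destruct d as [|d].
  - unfold enorm. rewrite sumlt_psum. simpl. rewrite sqrt_0. lra.
  - assert (HB : 0 <= B) by (eapply Rle_trans; [apply Rabs_pos | apply (H 0%nat); lia]).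
    unfold enorm. rewrite sumlt_psum, <- (sqrt_Rsqr B), <- sqrt_mult_alt by (auto || apply pos_INR).
    apply sqrt_le_1_alt. rewrite <- psum_const. apply psum_le. intros i Hi.
    specialize (H i Hi). pose proof (Rabs_pos (x i)).
    rewrite <- (pow2_abs (x i)). unfold Rsqr. simpl. nra.
Qed.

(* (A2) for R^d-valued functions implies its scalar form, testing with
   functions having d identical components. *)
Lemma scalar_A2_of_A2 d kI I : (0 < d)%nat -> AssumptionA2 d kI I ->
  exists C0, 0 <= C0 /\ scalar_A2 kI I C0.
Proof.
  intros Hd [C0 HA]. exists (Rmax C0 0 * INR (S kI)).
  split; [apply Rmult_le_pos; [apply Rmax_r | apply pos_INR] |].
  intros h Hh beta HB.
  assert (Hsd : 0 < sqrt (INR d)) by (apply sqrt_lt_R0, lt_0_INR; auto).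
  assert (Hbeta : 0 <= beta) by (eapply Rle_trans; [apply Rabs_pos | apply (HB 0%nat 0)]; lia || lra).
  specialize (HA (fun _ => h) (fun _ _ => Hh) (fun _ => sqrt (INR d) * beta)). cbv beta in HA.
  rewrite enorm_const, sumle_psum, psum_const in HA.
  assert (Habs : sqrt (INR d) * Rabs (I h) <= sqrt (INR d) * (C0 * (INR (S kI) * beta))).
  { eapply Rle_trans; [apply HA | right; ring].
    intros j s Hj Hs. rewrite enorm_const. apply Rmult_le_compat_l; [lra | auto]. }
  apply Rmult_le_reg_l in Habs; auto.
  eapply Rle_trans; [apply Habs |]. rewrite <- Rmult_assoc.
  apply Rmult_le_compat_r; [auto |]. apply Rmult_le_compat_r; [apply pos_INR | apply Rmax_l].
Qed.

(* Likewise for (A3); the number of derivatives entering the bound is at most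
   max kO kI + 1. *)
Lemma scalar_A3_of_A3 d kI kO O : (0 < d)%nat -> AssumptionA3 d kI kO O ->
  exists C1, 0 <= C1 /\ scalar_A3 kI kO O C1.
Proof.
  intros Hd [C1 HA]. exists (Rmax C1 0 * INR (S (Nat.max kO kI))).
  split; [apply Rmult_le_pos; [apply Rmax_r | apply pos_INR] |].
  intros l Hl h Hh beta HB s Hs.
  assert (Hsd : 0 < sqrt (INR d)) by (apply sqrt_lt_R0, lt_0_INR; auto).
  assert (Hbeta : 0 <= beta) by (eapply Rle_trans; [apply Rabs_pos | apply (HB 0%nat 0)]; lia || lra).
  specialize (HA l Hl (fun _ => h) (fun _ _ => Hh) (fun _ => sqrt (INR d) * beta)). cbv beta in HA.
  assert (Habs : sqrt (INR d) * Rabs (Derive_n (O h) l s)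
                 <= sqrt (INR d) * (C1 * (INR (S (Nat.max kO l)) * beta))).
  { rewrite <- enorm_const. eapply Rle_trans; [apply HA; auto | right].
    - intros j s' Hj Hs'. rewrite enorm_const. apply Rmult_le_compat_l; [lra | auto].
    - rewrite sumle_psum, psum_const. ring. }
  apply Rmult_le_reg_l in Habs; auto.
  eapply Rle_trans; [apply Habs |]. rewrite <- Rmult_assoc.
  apply Rmult_le_compat_r; [auto |].
  apply Rle_trans with (Rmax C1 0 * INR (S (Nat.max kO l))).
  - apply Rmult_le_compat_r; [apply pos_INR | apply Rmax_l].
  - apply Rmult_le_compat_l; [apply Rmax_r | apply le_INR; lia].
Qed.

(* The vector conditions defining J_n v yield the scalar ones for each component,
   testing with the monomial Tinv^m placed in that component. *)
Lemma is_J_components d r k I O a b v p : a < b -> is_J d r k I O a b v p ->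
  forall c, (c < d)%nat -> local_conditions r k I O a b (v c) (p c).
Proof.
  intros Hab [_ [HL [HR Hweak]]] c Hc. split; [| split].
  - intros Hk i Hi. apply HL; auto.
  - intros Hk i Hi. apply HR; auto.
  - intros m Hm.
    set (phi := fun c' t => if Nat.eqb c' c then Tinv a b t ^ m else 0).
    assert (Hsingle : forall x t, inner d x (fun c' => phi c' t) = x c * Tinv a b t ^ m).
    { intros x t. unfold inner, phi. rewrite sumlt_psum, (psum_single _ _ c Hc).
      - rewrite Nat.eqb_refl. reflexivity.
      - intros i _ Hi. apply Nat.eqb_neq in Hi. rewrite Hi. ring. }
    assert (Hphi : vpoly d (r - k) phi).
    { intros c' _. unfold phi. destruct (Nat.eqb c' c); [| apply poly_const].
      apply (poly_mono m); auto.
      apply (poly_ext _ (fun t => (- (b + a) / (b - a) + 2 / (b - a) * t) ^ m));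
        [intros; unfold Tinv; f_equal; field; lra | apply poly_affine_pow]. }
    specialize (Hweak phi Hphi). rewrite !Hsingle in Hweak.
    rewrite !(functional_extensionality (fun t => inner d _ (fun c0 => phi c0 t)) _
      (fun t => Hsingle _ t)) in Hweak.
    exact Hweak.
Qed.

(* Theorem 7.  The constant depends neither on the mesh nor on the data. *)
Theorem mainTheorem7 (d r k kI kO : nat) (I : functional) (O : operator) :
  (k <= r)%nat ->
  lin_functional kI I -> lin_operator kO O -> smoothing kO O ->
  AssumptionA1 r k I -> AssumptionA2 d kI I -> AssumptionA3 d kI kO O ->
  forall l : nat, (l <= r)%nat ->
  exists C : R,
    forall (N : nat) (t : nat -> R), mesh N t ->
    forall n : nat, (1 <= n <= N)%nat ->
    forall v p : vfun,
      vCk d (kJ k kI kO + 1) v ->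
      is_J d r k I O (t (n - 1)%nat) (t n) v p ->
      forall M : nat -> R,
        (forall j s, (j <= kJ k kI kO + 1)%nat -> t (n - 1)%nat < s <= t n ->
            enorm d (fun c => Derive_n (v c) j s) <= M j) ->
        forall s, t (n - 1)%nat < s <= t n ->
          enorm d (fun c => Derive_n (p c) l s)
          <= C * sumle (kJ k kI kO + 1)
                   (fun j => powerRZ ((t n - t (n - 1)%nat) / 2)
                               (Z.of_nat j - Z.of_nat l)%Z * M j).
Proof.
  intros Hkr HI HO Hsm HA1 HA2 HA3 l _.
  destruct (Nat.eq_dec d 0) as [->|Hd].
  { exists 0. intros. unfold enorm. rewrite sumlt_psum. simpl. rewrite sqrt_0. lra. }
  destruct (scalar_A2_of_A2 d kI I ltac:(lia) HA2) as [C0 [HC0 HA2s]].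
  destruct (scalar_A3_of_A3 d kI kO O ltac:(lia) HA3) as [C1 [HC1 HA3s]].
  destruct (local_stability r k kI kO I O C0 C1 l) as [K [_ HK]]; auto.
  exists (sqrt (INR d) * K). intros N t Hmesh n Hn v p Hv HJ M HM s Hs.
  destruct (Hmesh n Hn) as [Hab _].
  rewrite Rmult_assoc. apply enorm_bound. intros c Hc.
  apply (HK _ _ (v c) (p c) M Hab (Hv c Hc)); auto.
  - destruct HJ as [Hp _]. apply Hp; auto.
  - apply (is_J_components d); auto.
  - intros j s' Hj Hs'. eapply Rle_trans; [apply (enorm_component d (fun c => Derive_n (v c) j s') c Hc) |].
    apply HM; auto.
Qed.
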